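(* Suppose that $\hat\mu(t)=\sqrt t$ for all real $t\ge9$. Then Nagata's conjecture holds.
   Context: We work over $\mathbb{C}$. For $\xi\in\mathbb{C}[[x]]$ with $\xi(0)=0$ and real $t\ge 1$, the quasimonomial valuation $v(\xi,t)$ of $\mathbb{C}(x,y)$ is given on polynomials by $f\mapsto v(\xi,t;f)=\operatorname{ord}_x f(x,\xi(x)+\theta x^t)$, $\theta$ transcendental over $\mathbb{C}$; equivalently, if $f=\sum a_{ij}x^i(y-\xi(x))^j$, then $v(\xi,t;f)=\min\{i+tj\mid a_{ij}\ne0\}$. Put $\mu_d(\xi,t)=\max\{v(\xi,t;f)\mid 0\ne f\in\mathbb{C}[x,y],\ \deg f\le d\}$ and $\hat\mu(\xi,t)=\lim_{d\to\infty}\mu_d(\xi,t)/d$. For all very general $\xi$ (coefficients outside a countable union of proper Zariski closed conditions on jets) the function $\hat\mu(\xi,t)$ of $t$ is the same, denoted $\hat\mu(t)$. Nagata's conjecture: for every integer $r>9$ and $r$ very general points of $\mathbb{P}^2$, every plane curve of degree $d>0$ having multiplicity at least $m_i\geq 0$ at the $i$-th point ($1\le i\le r$) satisfies $d\sqrt r>\sum_{i=1}^r m_i$. *)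

(* Defs.v *)
From HB Require Import structures.
From mathcomp Require Import all_boot all_order all_algebra.
From mathcomp Require Import all_classical all_reals all_analysis.
From mathcomp Require Import complex.
From mathcomp Require mpoly.
(* The notations of mpoly clash with those of MathComp-Analysis. *)
Import -(notations) mpoly.

Set Implicit Arguments.
Unset Strict Implicit.
Unset Printing Implicit Defensive.

Import Order.TTheory GRing.Theory Num.Theory.
Import numFieldNormedType.Exports.

Local Open Scope classical_set_scope.
Local Open Scope ring_scope.

Notation CC R := (complex.complex R).
Notation "{ 'mpoly' T [ n ] }" := (mpoly n T)
  (at level 0, T at level 2, n at level 2, format "{ 'mpoly'  T [ n ] }").

Section VeryGeneral.
Variable R : realType.

Definition zero_locus n (S : set {mpoly CC R[n]}) : set ('I_n -> CC R) :=
  [set a | forall F, S F -> meval a F = 0].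

Definition proper_zariski_closed n (Z : set ('I_n -> CC R)) : Prop :=
  (exists S, Z = zero_locus S) /\ Z != setT.

(* xi stands for the series \sum_k xi k x^k, with xi 0 = 0; its n-jet is
   (xi 1, ..., xi n). *)
Definition jet n (xi : nat -> CC R) : 'I_n -> CC R := fun i => xi i.+1.

(* A union of countably many conditions: the k-th one is the condition Z k on
   jets of order N k. Finite unions are covered since Z k may be empty. *)
Definition for_very_general_series (Q : (nat -> CC R) -> Prop) : Prop :=
  exists (N : nat -> nat) (Z : forall k, set ('I_(N k) -> CC R)),
    (forall k, proper_zariski_closed (Z k)) /\
    forall xi : nat -> CC R, xi 0%N = 0 ->
      (forall k, ~ Z k (jet xi)) -> Q xi.

End VeryGeneral.

Section Valuation.
Variable R : realType.

Definition varx : {mpoly CC R[2]} := mpolyX (CC R) (mnm1 (0 : 'I_2)).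
Definition vary : {mpoly CC R[2]} := mpolyX (CC R) (mnm1 (1 : 'I_2)).

Definition series_trunc (xi : nat -> CC R) (n : nat) : {mpoly CC R[2]} :=
  \sum_(k < n.+1) mpolyC 2 (xi k) * varx ^+ k.

(* The a_ij of f = \sum a_ij x^i (y - xi(x))^j, i.e. the coefficient of
   x^i y^j in f(x, y + xi(x)). Powers x^k with k > i in xi do not contribute to
   it, so that xi may be truncated at order i. *)
Definition expansion_coef (xi : nat -> CC R) (f : {mpoly CC R[2]}) (i j : nat)
    : CC R :=
  mcoeff (Multinom [tuple i; j])
    (comp_mpoly [tuple varx; vary + series_trunc xi i] f).

(* v(xi, t; f) for f != 0 and t >= 1; the infimum is then a minimum. *)
Definition qmval (xi : nat -> CC R) (t : R) (f : {mpoly CC R[2]}) : R :=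
  inf [set s | exists i j : nat,
         expansion_coef xi f i j != 0 /\ s = i%:R + t * j%:R].

(* The supremum is a maximum: a valuation takes finitely many values on the
   nonzero elements of a finite dimensional space. *)
Definition mu (d : nat) (xi : nat -> CC R) (t : R) : R :=
  sup [set qmval xi t f | f in
         [set f : {mpoly CC R[2]} | f != 0 /\ (msize f <= d.+1)%N]].

Definition hat_mu (xi : nat -> CC R) (t : R) : R :=
  limn (fun d : nat => mu d xi t / d%:R).

(* The common function t |-> hat_mu xi t (t >= 1) of all very general xi. *)
Definition generic_hat_mu : R -> R :=
  xget (fun=> 0) [set m : R -> R |
    for_very_general_series (fun xi => forall t, 1 <= t -> hat_mu xi t = m t)].

End Valuation.

Section Nagata.
Variable R : realType.

(* r points of P^2, given by homogeneous coordinates (the rows of P). *)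
Definition is_configuration r (P : 'M[CC R]_(r, 3)) : Prop :=
  forall i, row i P != 0.

(* The variables of polynomials on (P^2)^r are indexed by mxvec_index i j, the
   j-th homogeneous coordinate of the i-th point. *)
Definition multihomogeneous r (F : {mpoly CC R[r * 3]}) : Prop :=
  exists D : 'I_r -> nat, forall m, m \in msupp F ->
    forall i, (\sum_(j < 3) (m : multinom _) (mxvec_index i j) = D i)%N.

Definition proper_closed_configurations r (Z : set 'M[CC R]_(r, 3)) : Prop :=
  (exists S : set {mpoly CC R[r * 3]},
     (forall F, S F -> multihomogeneous F) /\
     (forall P, is_configuration P ->
        (Z P <-> forall F, S F -> meval (fun k => mxvec P 0 k) F = 0))) /\
  (exists P, is_configuration P /\ ~ Z P).

Definition for_very_general_points r (Q : 'M[CC R]_(r, 3) -> Prop) : Prop :=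
  exists Z : nat -> set 'M[CC R]_(r, 3),
    (forall k, proper_closed_configurations (Z k)) /\
    forall P, is_configuration P -> (forall k, ~ Z k P) -> Q P.

(* Equation of the curve F = 0 in the affine chart X_k = p_k, with the point p
   translated to the origin (the variable X_k does not occur in it). *)
Definition local_equation (F : {mpoly CC R[3]}) (p : 'rV[CC R]_3) (k : 'I_3)
    : {mpoly CC R[3]} :=
  comp_mpoly
    [tuple mpolyC 3 (p 0 i) +
           (if i == k then 0 else mpolyX (CC R) (mnm1 i)) | i < 3] F.

Definition multiplicity_ge (F : {mpoly CC R[3]}) (p : 'rV[CC R]_3) (m : nat)
    : Prop :=
  forall k, p 0 k != 0 -> forall mm : multinom 3,
    (mdeg mm < m)%N -> mcoeff mm (local_equation F p k) = 0.

(* Plane curves of degree d are given by nonzero forms of degree d (they may be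
   reducible or nonreduced). *)
Definition nagata_conjecture : Prop :=
  forall r : nat, (9 < r)%N ->
    for_very_general_points (fun P : 'M[CC R]_(r, 3) =>
      forall (d : nat) (F : {mpoly CC R[3]}) (m : 'I_r -> nat),
        (0 < d)%N -> F != 0 -> F \is ishomog1 d mdeg ->
        (forall i, multiplicity_ge F (row i P) (m i)) ->
        (\sum_(i < r) m i)%:R < d%:R * Num.sqrt (r%:R : R)).

End Nagata.

(* Main.v *)
Require Import Defs.
From mathcomp Require Import all_boot all_order all_algebra.
From mathcomp Require Import all_classical all_reals all_analysis.
From mathcomp Require Import zify ring lra.
From mathcomp Require Import complex.
From mathcomp Require mpoly.
Import -(notations) mpoly.

(** Suppose that for some (d, m) with d > 0 and M = sum_i m_i >= d sqrt r every
configuration of r points carries a nonzero form of degree d having multiplicity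
at least m_i at the i-th point.  The points may then be moved along any
polynomial family of affine points over C[e], and linear algebra over C[e]
([solvable_limit]) yields a family F_e of equations of degree at most d, with
F_0 nonzero, whose member F_e has the prescribed multiplicities.  For points
(u_i, xi(u_i)) on a graph y = xi(x), the coefficient c_j(x) of y^j in
F(x, y + xi(x)) is divisible by prod_i (x - u_i)^(m_i - j)
([family_along_curve]).  This is used for two families.

Colliding points.  Take u_i = i e and let xi be a truncation of a very general
series.  At e = 0 the coefficient c_j is divisible by x^(M - r j), so that
v(xi, r; F_0) >= M ([specialize_to_germ]).  The powers of F_0 then give
hat_mu(xi, r) >= M / d, and the hypothesis at t = r yields M <= d sqrt r
([hat_mu_ge]).  Hence M = d sqrt r, so r = s^2 is a perfect square, s >= 4 and
M = s d.

Perfect squares.  Equality is excluded by Nagata's theorem on s^2 points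
([no_special_family]).  Put the points on the unicuspidal curve y = x^s, at
abscissas u_i with sum_i u_i n_i <> 0 for all nonzero weights n_i >= 0.  If f
has degree at most d, the polynomial f(x, x^s) has degree at most s d and, as
s >= 4, no monomial of degree s d - 1 or s d - 2 ([coef_restrict]).
A multiple of prod_i (x - u_i)^(n_i) of that shape, with
sum_i n_i >= s d > 0, must vanish: up to a constant it would be the product
itself, whose second coefficient is - sum_i n_i u_i
([prod_XsubC_multiple_eq0]).  It follows that F_0 = c (y - x^s)^k, with d = s k
and all m_i = k ([limit_form]).  Now deform the curve to
y = x^s + e x^(s^2 - 2).  The first-order term of F_e must contain a curve of
degree s that takes at the s^2 points the values - k c u_i^(s^2 - 2); its
restriction to y = x^s has no monomials of degrees s^2 - 1 and s^2 - 2, and the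
same argument gives k c = 0, a contradiction.

A proper closed set of configurations is obtained from one configuration
without such a form, by taking one maximal minor of the linear system which is
nonzero there ([closed_special_configurations]).  The hypothesis on hat_mu
applies to at least one series because countably many proper closed conditions
on jets can be avoided, C being uncountable ([very_general_series_exists]). *)

Set Implicit Arguments.
Unset Strict Implicit.
Unset Printing Implicit Defensive.

Import Order.TTheory GRing.Theory Num.Theory.
Import numFieldNormedType.Exports.
Local Open Scope ring_scope.

(** * Restriction of plane curves to the unicuspidal curve y = x^s *)

(** Plane polynomials are polynomials in y (outer) with coefficients in x
(inner).  The bound D is the total degree plus one, and the truncated
subtraction makes D = 0 characterize the zero polynomial. *)
Definition tdeg_lt (A : nzRingType) (D : nat) (f : {poly {poly A}}) : Prop :=
  forall j, (size (f`_j)%R <= D - j)%N.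

Section Curve.
Variables (A : idomainType).
Implicit Types f g : {poly {poly A}}.

(** The monomial x^a y^b restricts to x^(a + s b), and
s d - (a + s b) = s (d - b) - a >= (s - 1) (d - b) when a + b <= d; this exceeds
2 unless b = d, in which case a = 0. *)
Lemma coef_restrict (s d : nat) f n : (4 <= s)%N -> tdeg_lt d.+1 f ->
  (s * d <= n.+2)%N -> n != (s * d)%N -> (f.['X^s])`_n = 0.
Proof.
move=> s4 Pf dn nd; rewrite horner_coef coef_sum big1 // => j _.
rewrite -exprM coefMXn; case: ltnP => // sjn.
apply: nth_default; apply: leq_trans (Pf j) _.
case: (leqP j d) => jd; last by lia.
have [k dE] : exists k, d = (j + k)%N by exists (d - j)%N; lia.
move: nd dn; rewrite neq_ltn => /orP; rewrite dE mulnDr; case: k dE => [|k] dE.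
  by move: sjn; rewrite muln0 !addn0; move: (s * j)%N => q; lia.
have : (4 * k.+1 <= s * k.+1)%N by rewrite leq_mul2r s4 orbT.
move: sjn; move: (s * j)%N (s * k.+1)%N => p q.
lia.
Qed.

(** In the coefficient of y^j of the product, x^s g_j can only be cancelled
against g_(j-1), whose degree is already bounded. *)
Lemma tdeg_lt_divX_subX (s D : nat) g : (0 < s)%N ->
  tdeg_lt D (g * ('X - ('X^s)%:P)) -> tdeg_lt (D - s) g.
Proof.
move=> s0 Pf; elim=> [|j IHj].
  have := Pf 0%N; rewrite mulrBr coefB coefMX /= sub0r size_polyN coefMC.
  have [->|g0] := eqVneq g`_0 0; first by rewrite size_poly0.
  rewrite size_mulXn //; move: (size _) => k; lia.
have := Pf j.+1; rewrite mulrBr coefB coefMX /= coefMC.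
have [->|g0] := eqVneq g`_j.+1 0; first by rewrite size_poly0.
have E : g`_j.+1 * 'X^s = g`_j - (g`_j - g`_j.+1 * 'X^s) by ring.
have := size_polyD g`_j (- (g`_j - g`_j.+1 * 'X^s)).
rewrite -E size_polyN size_mulXn // leq_max; move: g0 IHj; rewrite -size_poly_gt0.
move: (size _) (size _) (size _) => p q t; lia.
Qed.

(** If the first j coefficients of f(x, y + x^s) in y vanish, then
f = (y - x^s)^j g and the next coefficient is g(x, x^s). *)
Lemma coef_shift_restrict (s D j : nat) f : (0 < s)%N -> tdeg_lt D f ->
  (forall i, (i < j)%N -> (f \Po ('X + ('X^s)%:P))`_i = 0) ->
  exists2 g, tdeg_lt (D - s * j) g & (f \Po ('X + ('X^s)%:P))`_j = g.['X^s].
Proof.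
move=> s0; elim: j D f => [|j IHj] D f Pf f0.
  exists f; first by rewrite muln0 subn0.
  by rewrite -horner_coef0 horner_comp !hornerE.
have := f0 0%N isT; rewrite -horner_coef0 horner_comp !hornerE => /eqP fx.
have /factor_theorem [g fE] : root f 'X^s by [].
have compE : f \Po ('X + ('X^s)%:P) = (g \Po ('X + ('X^s)%:P)) * 'X.
  by rewrite fE comp_polyM comp_polyB comp_polyX comp_polyC addrK.
have [||h Ph hE] := IHj (D - s)%N g.
- by apply: tdeg_lt_divX_subX => //; rewrite -fE.
- by move=> i ij; have := f0 i.+1 ij; rewrite compE coefMX.
exists h; first by rewrite mulnS subnDA.
by rewrite compE coefMX.
Qed.
End Curve.

(** * Multiplicity at the points of a graph *)

Definition translate (A : comNzRingType) (u v : A) (f : {poly {poly A}}) :=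
  map_poly (comp_poly ('X + u%:P)) f \Po ('X + v%:P%:P).

Definition mult_ge (A : comNzRingType) (f : {poly {poly A}}) (u v : A) (m : nat) :=
  forall a b, (a + b < m)%N -> (translate u v f)`_b`_a = 0.

Section Mult.
Variables (A : comNzRingType).

Lemma coef_XaddC_exp (h : A) n j :
  (('X + h%:P) ^+ n)`_j = h ^+ (n - j) *+ 'C(n, j).
Proof.
rewrite addrC exprDn coef_sum; case: (ltnP n j) => nj.
  rewrite bin_small // mulr0n big1 // => i _.
  rewrite -rmorphXn coefMn mul_polyC coefZ coefXn gtn_eqF ?mulr0 ?mul0rn //.
  by move: (ltn_ord i); lia.
have jn : (j < n.+1)%N by [].
rewrite (bigD1 (Ordinal jn)) //= big1 => [|i ij].
  by rewrite -rmorphXn coefMn mul_polyC coefZ coefXn eqxx mulr1 addr0.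
rewrite -rmorphXn coefMn mul_polyC coefZ coefXn.
case: eqP => [E|]; last by rewrite mulr0 mul0rn.
by case/eqP: ij; apply: val_inj.
Qed.

Lemma coef_comp_XaddC (f : {poly A}) (h : A) j :
  (f \Po ('X + h%:P))`_j = \sum_(n < size f) f`_n * (h ^+ (n - j) *+ 'C(n, j)).
Proof.
rewrite comp_polyE coef_sum; apply: eq_bigr => n _.
by rewrite coefZ coef_XaddC_exp.
Qed.

Lemma dvdXnP (p : {poly A}) n :
  (forall i, (i < n)%N -> p`_i = 0) <-> exists q, p = q * 'X^n.
Proof.
split=> [p0|[q ->] i ni]; last by rewrite coefMXn ni.
exists (drop_poly n p); rewrite -[LHS](poly_take_drop n).
suff -> : take_poly n p = 0 by rewrite add0r.
by apply/polyP => i; rewrite coef_take_poly coef0; case: ifP => // /p0.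
Qed.
End Mult.

(** After moving the point to the origin the graph becomes y = x z(x).  In
the expansion along it, a monomial y^n whose coefficient is divisible by
x^(m - n) contributes x^(m - n) (x z)^(n - j) to the coefficient of y^j. *)
Lemma dvd_along_curve (A : comNzRingType) (f : {poly {poly A}}) (xi : {poly A}) u m :
  mult_ge f u xi.[u] m ->
  forall j, exists q, (f \Po ('X + xi%:P))`_j = q * ('X - u%:P) ^+ (m - j).
Proof.
move=> fm j; pose tau : {rmorphism {poly A} -> {poly A}} := comp_poly ('X + u%:P).
have [z xiE] : exists z, tau xi = (xi.[u])%:P + z * 'X.
  have /factor_theorem[z zE] : root (tau xi - (xi.[u])%:P) 0.
    by rewrite /root hornerD horner_comp !hornerE subrr.
  by exists z; move: zE; rewrite subr0 => <-; rewrite addrC subrK.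
pose S := translate u xi.[u] f.
have SE : map_poly tau (f \Po ('X + xi%:P)) = S \Po ('X + (z * 'X)%:P).
  rewrite map_comp_poly rmorphD /= map_polyX map_polyC /= -/tau xiE.
  rewrite /S /translate -comp_polyA comp_polyD comp_polyX comp_polyC.
  by rewrite polyCD addrAC addrA.
have [q qE] : exists q, tau (f \Po ('X + xi%:P))`_j = q * 'X^(m - j).
  rewrite -coef_map SE coef_comp_XaddC.
  apply: (big_ind (fun p => exists q, p = q * 'X^(m - j))).
  - by exists 0; rewrite mul0r.
  - by move=> _ _ [q1 ->] [q2 ->]; exists (q1 + q2); rewrite mulrDl.
  move=> n _; case: (ltnP n j) => nj.
    by exists 0; rewrite bin_small // mulr0n mulr0 mul0r.
  have /dvdXnP[q ->] : forall i, (i < m - n)%N -> S`_n`_i = 0.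
    by move=> i im; apply: fm; lia.
  exists (q * (z ^+ (n - j) *+ 'C(n, j)) * 'X^((m - n) + (n - j) - (m - j))).
  rewrite -[in RHS]mulrA -exprD subnK; last by lia.
  rewrite exprD exprMn -[_ *+ _]mulr_natr -[z ^+ _ *+ _]mulr_natr; ring.
exists (q \Po ('X - u%:P)).
have -> : ('X - u%:P) ^+ (m - j) = 'X^(m - j) \Po ('X - u%:P).
  by rewrite rmorphXn /= comp_polyX.
rewrite -comp_polyM -qE /tau -comp_polyA comp_polyD comp_polyX comp_polyC.
by rewrite subrK comp_polyXr.
Qed.

Section Distinct.
Variable A : idomainType.

Lemma cancel_XsubC_exp (p q P : {poly A}) u n : P.[u] != 0 ->
  p * P = q * ('X - u%:P) ^+ n -> exists p', p = p' * ('X - u%:P) ^+ n.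
Proof.
move=> Pu; elim: n p q => [|n IHn] p q E; first by exists p; rewrite mulr1.
have /factor_theorem[p1 pE] : root p u.
  have /(congr1 (horner^~ u)) := E.
  rewrite exprS !hornerM hornerXsubC subrr mul0r mulr0 => /eqP.
  by rewrite mulf_eq0 (negPf Pu) orbF.
have [|p' p'E] := IHn p1 q; last by exists p'; rewrite pE p'E exprSr mulrA.
apply: (@mulfI _ ('X - u%:P)); first by rewrite polyXsubC_eq0.
by rewrite mulrA [_ * p1]mulrC -pE E exprS; ring.
Qed.

(** The coefficient ring is only a domain, so distinct linear factors need not
be comaximal; they are cancelled one at a time by evaluation at their root. *)
Lemma dvd_prod_XsubC_exp (I : eqType) (r : seq I) (u : I -> A) (n : I -> nat) c :
  uniq r -> injective u ->
  (forall i, i \in r -> exists q, c = q * ('X - (u i)%:P) ^+ n i) ->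
  exists q, c = q * \prod_(i <- r) ('X - (u i)%:P) ^+ n i.
Proof.
move=> + uI; elim: r => [|k r IHr] /= => [_ _|/andP[kr ur] cd].
  by exists c; rewrite big_nil mulr1.
have [|q qE] := IHr ur; first by move=> i ir; apply: cd; rewrite inE ir orbT.
have [q1 q1E] := cd k (mem_head _ _).
have rk : (\prod_(i <- r) ('X - (u i)%:P) ^+ n i).[u k] != 0.
  rewrite horner_prod prodf_seq_neq0; apply/allP => i ir /=.
  rewrite horner_exp hornerXsubC expf_neq0 // subr_eq0.
  by apply: contra kr => /eqP/uI ->.
have [p' p'E] := cancel_XsubC_exp rk (etrans (esym qE) q1E).
exists p'; rewrite big_cons mulrA -p'E; exact: qE.
Qed.
End Distinct.

(** * Multiples of a product of linear factors *)

Section Roots.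
Variable A : idomainType.

Lemma prod_XsubC_expE (I : Type) (r : seq I) (u : I -> A) (n : I -> nat) :
  exists rs : seq A,
    [/\ \prod_(i <- r) ('X - (u i)%:P) ^+ n i = \prod_(z <- rs) ('X - z%:P),
        size rs = (\sum_(i <- r) n i)%N & \sum_(z <- rs) z = \sum_(i <- r) u i *+ n i].
Proof.
elim: r => [|i r [rs [E1 E2 E3]]]; first by exists [::]; rewrite !big_nil.
exists (nseq (n i) (u i) ++ rs); rewrite !big_cons !big_cat !big_nseq iter_mulr_1.
by rewrite iter_addr_0 size_cat size_nseq E1 E2 E3.
Qed.

(** By degree, h is a constant times the product; the coefficient after the
leading one of the product is minus the sum of the roots. *)
Lemma prod_XsubC_multiple_eq0 (h q : {poly A}) (rs : seq A) N :
  (0 < N <= size rs)%N -> \sum_(z <- rs) z != 0 -> (size h <= N.+1)%N ->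
  h`_N.-1 = 0 -> h = q * \prod_(z <- rs) ('X - z%:P) -> h = 0.
Proof.
move=> /andP[N0 Nrs] rs0 hN h0 hE; have [q0|q0] := eqVneq q 0.
  by rewrite hE q0 mul0r.
have sh : size h = (size q + size rs)%N.
  by rewrite hE size_Mmonic ?monic_prod_XsubC // size_prod_XsubC addnS.
have qs : size q = 1%N /\ size rs = N.
  by move: q0 hN Nrs; rewrite -size_poly_gt0 sh; move: (size q) (size rs) => a b; lia.
case: qs => /eqP/size_poly1P[c c0 qE] rsN.
move: h0; rewrite hE qE coefCM -rsN coefPn_prod_XsubC ?rsN -?lt0n // => /eqP.
by rewrite mulf_eq0 oppr_eq0 (negPf c0) (negPf rs0).
Qed.
End Roots.

(** * Nagata's theorem for a square number of points *)

Section Taylor.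
Variable A : comNzRingType.

Lemma comp_poly_taylor1 (p q h : {poly A}) :
  exists R, p \Po (q + h) = p \Po q + R * h.
Proof.
elim/poly_ind: p => [|p c [R IH]]; first by exists 0; rewrite !comp_poly0 mul0r addr0.
exists (R * q + R * h + (p \Po q)).
by rewrite !comp_poly_MXaddC IH; ring.
Qed.

Lemma comp_poly_taylor2 (p q h : {poly A}) :
  exists R, p \Po (q + h) = p \Po q + (p^`() \Po q) * h + R * h ^+ 2.
Proof.
elim/poly_ind: p => [|p c [R IH]].
  by exists 0; rewrite deriv0 !comp_poly0 !mul0r !addr0.
exists (R * q + R * h + (p^`() \Po q)).
rewrite derivD derivC addr0 derivM derivX mulr1.
rewrite !(comp_polyD, comp_polyM, comp_polyX, comp_polyC) IH; ring.
Qed.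
End Taylor.

Section Square.
Variables (C : numFieldType) (s : nat).
Let r := (s * s)%N.

(** The nodes are 1, ..., s^2, so every nontrivial nonnegative combination of
them is nonzero in characteristic 0. *)
Lemma node_sum (n : 'I_r -> nat) (i0 : 'I_r) : (0 < n i0)%N ->
  \sum_(i <- enum 'I_r) (i.+1%:R : C) *+ n i != 0.
Proof.
move=> n0; rewrite big_enum /=.
under eq_bigr do rewrite -[_ *+ _]mulr_natr -natrM.
rewrite -natr_sum pnatr_eq0 -lt0n (bigD1 i0) //=; lia.
Qed.

Definition nodes (n : 'I_r -> nat) : {poly C} :=
  \prod_(i <- enum 'I_r) ('X - (i.+1%:R)%:P) ^+ n i.

Lemma nodes_multiple_eq0 (n : 'I_r -> nat) N (h q : {poly C}) :
  (0 < N <= \sum_i n i)%N -> (size h <= N.+1)%N -> h`_N.-1 = 0 ->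
  h = q * nodes n -> h = 0.
Proof.
move=> nN hN h0 hE.
have [rs [E1 E2 E3]] := prod_XsubC_expE (enum 'I_r) (fun i => i.+1%:R : C) n.
apply: (@prod_XsubC_multiple_eq0 C h q rs N) => //; last by rewrite hE /nodes E1.
  by rewrite E2 big_enum.
rewrite E3; have /existsP[i0 ni0] : [exists i, (0 < n i)%N].
  apply: contraTT nN => /existsPn n0; rewrite big1 => [|i _].
    by rewrite leqn0 andbC; case: eqP => // ->.
  by apply/eqP; move: (n0 i); rewrite -eqn0Ngt.
exact: node_sum ni0.
Qed.

Hypothesis s4 : (4 <= s)%N.

Lemma size_restrict d (g : {poly {poly C}}) :
  tdeg_lt d.+1 g -> (size g.['X^s] <= (s * d).+1)%N.
Proof.
move=> Pg; apply/leq_sizeP => n dn; apply: (coef_restrict s4 Pg); first by lia.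
by rewrite gtn_eqF.
Qed.

(** The first nonzero coefficient Q_k of f(x, y + x^s) is g(x, x^s) with g of
degree e = d - s k.  It is divisible by a product of sum_i (m_i - k) >= s e
linear factors, so e > 0 is impossible; then Q_k is a constant, which forces
m_i <= k for all i. *)
Lemma limit_form d (m : 'I_r -> nat) (f : {poly {poly C}}) :
  tdeg_lt d.+1 f -> f != 0 -> (s * d <= \sum_i m i)%N ->
  (forall j, exists q, (f \Po ('X + ('X^s)%:P))`_j = q * nodes (fun i => (m i - j)%N)) ->
  exists k c, [/\ c != 0, d = (s * k)%N, forall i, m i = k,
     forall j, (j < k)%N -> (f \Po ('X + ('X^s)%:P))`_j = 0 &
     (f \Po ('X + ('X^s)%:P))`_k = c%:P].
Proof.
move=> Pf f0 dm fd; set Q := f \Po _ in fd *.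
have s0 : (0 < s)%N by lia.
have Q0 : Q != 0.
  rewrite -size_poly_eq0 /Q size_comp_poly2 ?size_poly_eq0 //; exact: size_XaddC.
have exk : exists k, Q`_k != 0.
  by exists (size Q).-1; rewrite -/(lead_coef Q) lead_coef_eq0.
case: (ex_minnP exk) => k Qk kmin.
have Qlt j : (j < k)%N -> Q`_j = 0.
  by move=> jk; apply/eqP; apply: contraTT jk => /kmin; rewrite -leqNgt.
have [g Pg gE] := coef_shift_restrict s0 Pf Qlt.
have skd : (s * k <= d)%N.
  rewrite leqNgt; apply/negP => dsk; case/eqP: Qk; rewrite /Q gE.
  suff -> : g = 0 by rewrite horner0.
  apply/polyP => j; rewrite coef0; apply/eqP; rewrite -size_poly_eq0 -leqn0.
  by apply: leq_trans (Pg j) _; lia.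
have [e dE] : exists e, d = (s * k + e)%N by exists (d - s * k)%N; lia.
have {}Pg : tdeg_lt e.+1 g by move: Pg; have -> : (d.+1 - s * k = e.+1)%N by lia.
have [q qE] := fd k.
have sum_ge : (s * e <= \sum_i (m i - k))%N.
  have : (\sum_i m i <= \sum_i (m i - k) + \sum_(i < r) k)%N.
    by rewrite -big_split; apply: leq_sum => i _ /=; lia.
  rewrite sum_nat_const card_ord; move: dm; rewrite dE /r; move: (\sum_i _)%N (\sum_i _)%N; nia.
have e0 : e = 0%N.
  apply/eqP; apply: contraNT Qk; rewrite -lt0n => e0; apply/eqP.
  have se : (4 * e <= s * e)%N by rewrite leq_mul2r s4 orbT.
  apply: (nodes_multiple_eq0 _ _ _ qE (N := (s * e)%N)).
  - by rewrite sum_ge andbT; lia.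
  - by rewrite /Q gE size_restrict.
  - by rewrite /Q gE (coef_restrict s4 Pg) //; [lia|apply/negP => /eqP; lia].
have sQ : (size (Q`_k)%R <= 1)%N by rewrite /Q gE; move: (size_restrict Pg); rewrite e0 muln0.
have /size1_polyC QkE := sQ.
have mk i : (m i <= k)%N.
  have : (\sum_i (m i - k) = 0)%N.
    have [rs [E1 E2 E3]] := prod_XsubC_expE (enum 'I_r) (fun i => i.+1%:R : C)
      (fun i => m i - k)%N.
    rewrite -[LHS]big_enum -E2; apply/eqP; rewrite -leqn0.
    move: sQ Qk; rewrite qE /nodes E1 => sQ.
    have [->|q0] := eqVneq q 0; first by rewrite mul0r eqxx.
    move: sQ; rewrite size_Mmonic ?monic_prod_XsubC // size_prod_XsubC addnS /=.
    by move: q0; rewrite -size_poly_gt0; move: (size q) (size rs) => a b; lia.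
  by move/eqP; rewrite sum_nat_eq0 => /forallP/(_ i)/=; lia.
exists k, (Q`_k)`_0; split => //.
- by apply: contraNneq Qk => c0; rewrite QkE c0.
- by rewrite dE e0 addn0.
move=> i; apply/eqP; rewrite eqn_leq mk /= leqNgt; apply/negP => mik.
have : (\sum_i m i < \sum_(i < r) k)%N.
  rewrite (bigD1 i) //= [X in (_ < X)%N](bigD1 i) //=.
  by rewrite -addSn leq_add // leq_sum.
by rewrite sum_nat_const card_ord; move: dm; rewrite dE e0 addn0 /r mulnA; lia.
Qed.
End Square.

(** Families of plane polynomials have a third, innermost variable e; [at0] is
the specialization e = 0. *)
Definition at0 (C : comNzRingType) : {rmorphism {poly C} -> C} := horner_eval 0.

Section Eps.
Variable C : fieldType.

Lemma at0C (c : C) : at0 C c%:P = c.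
Proof. exact: hornerC. Qed.

Lemma at0X : at0 C 'X = 0.
Proof. exact: hornerX. Qed.

Lemma map_at0C (p : {poly C}) : map_poly (at0 C) (map_poly polyC p) = p.
Proof. by apply/polyP => i; rewrite !coef_map; apply: at0C. Qed.

Lemma at0_divX (p : {poly C}) : p = (at0 C p)%:P + 'X * drop_poly 1 p.
Proof.
rewrite -[LHS](poly_take_drop 1) mulrC; congr (_ + _).
by apply/polyP => -[|i]; rewrite coef_take_poly coefC //= -horner_coef0.
Qed.

Lemma poly_at0_divX (p : {poly {poly C}}) : map_poly (at0 C) p = 0 ->
  exists q, p = 'X%:P * q.
Proof.
move=> p0; exists (map_poly (drop_poly 1 : {linear {poly C} -> {poly C}}) p).
apply/polyP => i; rewrite coefCM coef_map [LHS]at0_divX -[at0 C _]coef_map p0.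
by rewrite coef0 add0r.
Qed.

Lemma tdeg_lt_map (A B : nzRingType) (g : {additive {poly A} -> {poly B}}) D f :
  (forall p, size (g p) <= size p)%N -> tdeg_lt D f -> tdeg_lt D (map_poly g f).
Proof. by move=> gs Pf j; rewrite coef_map; apply: leq_trans (gs _) (Pf j). Qed.

Lemma tri_at0_divX (F : {poly {poly {poly C}}}) D : tdeg_lt D F ->
  exists2 G, tdeg_lt D G &
   F = map_poly (map_poly polyC) (map_poly (map_poly (at0 C)) F) + 'X%:P%:P * G.
Proof.
move=> PF; pose dr := drop_poly 1 : {linear {poly C} -> {poly C}}.
exists (map_poly (map_poly dr) F).
  by apply: tdeg_lt_map PF => p; apply: size_poly.
apply/polyP => j; rewrite coefD coefCM !coef_map /=.
apply/polyP => i; rewrite coefD coefCM !coef_map /=; exact: at0_divX.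
Qed.
End Eps.

Section Square.
Variables (C : numFieldType) (s : nat).
Hypothesis s4 : (4 <= s)%N.
Let r := (s * s)%N.

(** Write F = F0 + e F1 and expand F along the curve y = x^s + e w to first
order in e: the coefficient of y^j is e (F1_j + w (F0_y)_j) + O(e^2) for j < k,
where all coefficients are taken along y = x^s.  Since the product N j does not
depend on e, it also divides the quotient of this coefficient by e. *)
Lemma first_order (w : {poly C}) k (F : {poly {poly {poly C}}}) D
    (N : nat -> {poly C}) :
  tdeg_lt D F -> (forall j, N j \is monic) ->
  let F0 := map_poly (map_poly (at0 C)) F in
  let Z := 'X + ('X^s)%:P in
  (forall j, (j < k)%N -> (F0 \Po Z)`_j = 0) ->
  (forall j, exists q,
     (F \Po ('X + ('X^s + 'X%:P * map_poly polyC w)%:P))`_j = q * map_poly polyC (N j)) ->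
  exists2 G, tdeg_lt D G & forall j, (j < k)%N -> exists q,
     (G \Po Z)`_j + w * (F0 \Po Z)`_j.+1 *+ j.+1 = q * N j.
Proof.
move=> PF Nmon F0 Z F0lt Fd; have [F1 PF1 FE] := tri_at0_divX PF.
exists (map_poly (map_poly (at0 C)) F1).
  by apply: tdeg_lt_map PF1 => p; apply: size_poly.
pose Z1 : {poly {poly {poly C}}} := 'X + ('X^s)%:P.
pose e : {poly {poly C}} := 'X%:P.
pose W := map_poly polyC w.
have ZE : 'X + ('X^s + e * W)%:P = Z1 + (e * W)%:P by rewrite polyCD addrA.
have Z1E : Z1 = map_poly (map_poly polyC) Z.
  by rewrite /Z rmorphD /= map_polyX map_polyC /= map_polyXn.
have Z1E' : map_poly (map_poly (at0 C)) Z1 = Z.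
  by rewrite /Z1 rmorphD /= map_polyX map_polyC /= map_polyXn.
move=> j jk; have [q qE] := Fd j.
have [R RE] := comp_poly_taylor2 (map_poly (map_poly polyC) F0) Z1 (e * W)%:P.
have [R1 R1E] := comp_poly_taylor1 F1 Z1 (e * W)%:P.
pose T := map_poly polyC (F0^`() \Po Z)`_j * W + (F1 \Po Z1)`_j + e * (R1`_j * W + R`_j * W ^+ 2).
have QE : (F \Po ('X + ('X^s + e * W)%:P))`_j = e * T.
  rewrite ZE FE comp_polyD comp_polyM comp_polyC RE R1E.
  rewrite -/e -polyC_exp 3!coefD 2!coefMC coefCM coefD coefMC.
  rewrite Z1E -map_comp_poly coef_map /= F0lt // rmorph0 add0r.
  rewrite -Z1E deriv_map Z1E -map_comp_poly coef_map /= -Z1E /T; ring.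
(* At e = 0 the relation Q_j = q N_j reads 0 = q(0) N_j, so e divides q. *)
have [q1 q1E] : exists q1, q = e * q1.
  apply: poly_at0_divX; apply/eqP; have := congr1 (map_poly (at0 C)) qE.
  rewrite /= -/e -/W QE !rmorphM /= map_polyC /= at0X mul0r map_at0C => /esym/eqP.
  by rewrite mulf_eq0 (negPf (monic_neq0 (Nmon j))) orbF.
have TE : T = q1 * map_poly polyC (N j).
  apply: (@mulfI _ e); first by rewrite polyC_eq0 polyX_eq0.
  by rewrite -QE qE q1E mulrA.
exists (map_poly (at0 C) q1); have := congr1 (map_poly (at0 C)) TE.
rewrite /= rmorphM /= map_at0C => <-.
rewrite /T !rmorphD !rmorphM /= !map_at0C map_polyC /= at0X mul0r addr0.
rewrite -(coef_map (map_poly (at0 C))) map_comp_poly Z1E' addrC; congr (_ + _).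
have -> : F0^`() \Po Z = (F0 \Po Z)^`().
  by rewrite deriv_comp derivD derivX derivC addr0 mulr1.
by rewrite coef_deriv mulrnAl mulrC.
Qed.

(** With F0 = c (y - x^s)^k as in [limit_form], the first-order term G has
vanishing coefficients below k - 1, and its coefficient of index k - 1 is
h = g(x, x^s) with g of degree at most s.  By [first_order], h + k c w is
divisible by the product of all x - u_i.  For w = x^(s^2 - 2) it has no monomial
of degree s^2 - 1, hence it vanishes, although its coefficient of degree s^2 - 2
is k c. *)
Lemma no_special_family d (m : 'I_r -> nat) (F : {poly {poly {poly C}}}) :
  tdeg_lt d.+1 F -> map_poly (map_poly (at0 C)) F != 0 -> (0 < d)%N ->
  (s * d <= \sum_i m i)%N ->
  (forall j, exists q,
     (F \Po ('X + ('X^s + 'X%:P * 'X^(r - 2))%:P))`_j =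
        q * map_poly polyC (nodes C (fun i => m i - j)%N)) -> False.
Proof.
move=> PF F0n d0 dm Fd.
set F0 := map_poly (map_poly (at0 C)) F in F0n.
have PF0 : tdeg_lt d.+1 F0 by apply: tdeg_lt_map PF => p; apply: size_poly.
have s0 : (0 < s)%N by lia.
have nodes_monic n : @nodes C s n \is monic.
  by rewrite /nodes; apply: monic_prod => i _; rewrite monic_exp ?monicXsubC.
have [k [c [c0 dk mk F0lt F0k]]] : exists k c, [/\ c != 0, d = (s * k)%N, forall i, m i = k,
     forall j, (j < k)%N -> (F0 \Po ('X + ('X^s)%:P))`_j = 0 &
     (F0 \Po ('X + ('X^s)%:P))`_k = c%:P].
  apply: (limit_form s4 PF0 F0n dm) => j; have [q qE] := Fd j.
  exists (map_poly (at0 C) q); have := congr1 (map_poly (at0 C)) qE.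
  rewrite /= rmorphM /= map_at0C => <-; rewrite -(coef_map (map_poly (at0 C))) map_comp_poly.
  rewrite rmorphD /= map_polyX map_polyC /= rmorphD rmorphM /= map_polyC /= at0X mul0r addr0.
  by rewrite map_polyXn.
have [] := @first_order 'X^(r - 2) k F d.+1 (fun j => @nodes C s (fun i => m i - j)%N) PF _ F0lt _.
- by move=> j; apply: nodes_monic.
- by move=> j; have [q qE] := Fd j; exists q; rewrite map_polyXn.
move=> G PG /= Gd.
have sum_m j : (\sum_i (m i - j) = s * (s * (k - j)))%N.
  by under eq_bigr do rewrite mk; rewrite sum_nat_const card_ord /r mulnA.
have G0 j : (j < k.-1)%N -> (G \Po ('X + ('X^s)%:P))`_j = 0.
  elim/ltn_ind: j => j IHj jk.
  have [g Pg gE] : exists2 g, tdeg_lt (d.+1 - s * j) g & (G \Po ('X + ('X^s)%:P))`_j = g.['X^s].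
    by apply: coef_shift_restrict => // i ij; apply: IHj => //; lia.
  have {}Pg : tdeg_lt (s * (k - j)).+1 g.
    move: Pg; have -> // : (d.+1 - s * j = (s * (k - j)).+1)%N.
    by rewrite dk mulnBr subSn // leq_mul2l; lia.
  have [|q] := Gd j; first by lia.
  rewrite F0lt; last by lia.
  rewrite mulr0 mul0rn addr0 => qE.
  have kj : (4 * (4 * 1) <= s * (s * (k - j)))%N by rewrite !leq_mul //; lia.
  apply: (nodes_multiple_eq0 _ _ _ qE (N := (s * (s * (k - j)))%N)).
  - by rewrite sum_m leqnn; lia.
  - by rewrite gE size_restrict.
  - by rewrite gE (coef_restrict s4 Pg) //; [lia|apply/negP => /eqP; lia].
have k0 : (0 < k)%N by case: k dk {F0lt F0k mk Gd sum_m G0} => //; lia.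
have [g Pg gE] : exists2 g, tdeg_lt (d.+1 - s * k.-1) g & (G \Po ('X + ('X^s)%:P))`_k.-1 = g.['X^s].
  by apply: coef_shift_restrict.
have {}Pg : tdeg_lt s.+1 g.
  by move: Pg; have -> // : (d.+1 - s * k.-1 = s.+1)%N; rewrite dk -{1}(prednK k0) mulnS; lia.
have [|q qE] := Gd k.-1; first by lia.
have ss : (4 * 4 <= s * s)%N by rewrite leq_mul.
have s2 : (r - 2 < r)%N by rewrite /r; lia.
rewrite prednK // F0k in qE.
have h0 : g.['X^s] + 'X^(r - 2) * c%:P *+ k = 0.
  rewrite -gE; apply: (nodes_multiple_eq0 _ _ _ qE (N := (s * s)%N)).
  - rewrite sum_m; have -> : (k - k.-1 = 1)%N by lia.
    by rewrite muln1 leqnn; lia.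
  - rewrite gE; apply: leq_trans (size_polyD _ _) _; rewrite geq_max (size_restrict s4 Pg) /=.
    rewrite -mulrnAr -polyCMn mulrC mul_polyC; apply: leq_trans (size_scale_leq _ _) _.
    by rewrite size_polyXn; lia.
  - rewrite gE coefD (coef_restrict s4 Pg) //; [|lia|by apply/negP => /eqP; lia].
    by rewrite add0r coefMn mulrC mul_polyC coefZ coefXn gtn_eqF ?mulr0 ?mul0rn // /r; lia.
have := congr1 (fun p : {poly C} => p`_(r - 2)) h0.
rewrite coefD (coef_restrict s4 Pg) //; last first.
- by apply/negP => /eqP; rewrite /r; lia.
- by rewrite /r; lia.
rewrite add0r coefMn mulrC mul_polyC coefZ coefXn eqxx mulr1 coef0 => /eqP.
by rewrite mulrn_eq0 (negPf c0) orbF; lia.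
Qed.
End Square.

(** * Linear systems depending polynomially on a parameter *)

Definition solvable (K : nzRingType) (U T : finType) (A : U -> T -> K) : Prop :=
  exists v : T -> K, (exists t, v t != 0) /\ forall u, \sum_t A u t * v t = 0.

Definition minor (K : comNzRingType) (U T : finType) (A : U -> T -> K) (g : 'I_#|T| -> U) : K :=
  \det (\matrix_(i < #|T|, j < #|T|) A (g i) (enum_val j)).

Lemma rmorph_minor (K L : comNzRingType) (phi : {rmorphism K -> L}) (U T : finType)
    (A : U -> T -> K) g : phi (minor A g) = minor (fun u t => phi (A u t)) g.
Proof. by rewrite -det_map_mx; congr (\det _); apply/matrixP => i j; rewrite !mxE. Qed.

Section Field.
Variables (K : fieldType) (U T : finType) (A : U -> T -> K).

Lemma solvable_minor0 g : solvable A -> minor A g = 0.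
Proof.
move=> [v [[t vt] Av]]; apply/eqP; rewrite /minor -det_tr; apply/det0P.
exists (\row_j v (enum_val j)).
  apply: contraNneq vt => /rowP/(_ (enum_rank t)); rewrite !mxE enum_rankK => ->//.
apply/rowP => i; rewrite !mxE -[RHS](Av (g i)) (reindex (@enum_val T T)) /=; last first.
  by apply: onW_bij; apply: enum_val_bij.
by apply: eq_bigr => j _; rewrite !mxE mulrC.
Qed.

Lemma solvable_or_minor : solvable A \/ exists g, minor A g != 0.
Proof.
pose M := \matrix_(i < #|U|, j < #|T|) A (enum_val i) (enum_val j).
case: (boolP (row_full M)) => [fM|].
  right; exists (fun i => enum_val (fullrankfun fM i)).
  have := fullrowsub_unit fM; rewrite unitmxE unitfE.
  by congr (\det _ != 0); apply/matrixP => i j; rewrite !mxE.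
rewrite /row_full -mxrank_tr -/(row_free _) -kermx_eq0 => k0; left.
have /existsP[i ki] : [exists i, row i (kermx M^T) != 0].
  apply: contraNT k0 => /existsPn k0; apply/eqP/row_matrixP => i.
  by rewrite row0; apply/eqP; rewrite -[_ == _]negbK; apply: k0.
exists (fun t => kermx M^T i (enum_rank t)); split.
  have /existsP[j kj] : [exists j, kermx M^T i j != 0].
    apply: contraNT ki => /existsPn ki; apply/eqP/rowP => j; rewrite [RHS]mxE [LHS]mxE.
    by apply/eqP; rewrite -[_ == _]negbK; apply: ki.
  by exists (enum_val j); rewrite enum_valK.
move=> u; have /matrixP/(_ i (enum_rank u)) := mulmx_ker M^T.
rewrite !mxE => E; rewrite -[RHS]E (reindex (@enum_val T T)) /=; last first.
  by apply: onW_bij; apply: enum_val_bij.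
by apply: eq_bigr => j _; rewrite enum_valK [M^T _ _]mxE [M _ _]mxE enum_rankK mulrC.
Qed.
End Field.

Lemma fraction_clear (R : idomainType) (x : {fraction R}) :
  exists n d : R, d != 0 /\ x * FracField.tofrac d = FracField.tofrac n.
Proof.
have [y ->] : exists y, x = (\pi_{fraction R} y)%qT by exists (repr x); rewrite reprK.
exists (y : R * R).1, (y : R * R).2; split; first exact: denom_ratioP.
unlock FracField.tofrac; rewrite -[LHS]FracField.pi_mul; apply/eqmodP => /=.
rewrite FracField.equivfE /FracField.mulf !(fun x => numer_Ratio x (oner_neq0 R)).
rewrite !(fun x => denom_Ratio x (oner_neq0 R)) !mulr1.
by rewrite numer_Ratio ?denom_Ratio ?denom_ratioP // mulrC.
Qed.

Lemma solvable_fraction (R : idomainType) (U T : finType) (A : U -> T -> R) :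
  solvable (fun u t => FracField.tofrac (A u t)) -> solvable A.
Proof.
move=> [v [[t0 vt0] Av]].
have [D D0 vD] : exists2 D : R, D != 0 &
    forall t, exists n, v t * FracField.tofrac D = FracField.tofrac n.
  suff [D D0 vD] : exists2 D : R, D != 0 &
      forall t, t \in enum T -> exists n, v t * FracField.tofrac D = FracField.tofrac n.
    by exists D => // t; apply: vD; rewrite mem_enum.
  elim: (enum T) => [|t s [D D0 IH]]; first by exists 1; rewrite ?oner_neq0.
  have [n [d [d0 E]]] := fraction_clear (v t).
  exists (d * D); first by rewrite mulf_neq0.
  move=> t'; rewrite inE => /orP[/eqP ->|/IH[n' E']].
    by exists (n * D); rewrite !tofracM mulrA E.
  by exists (n' * d); rewrite !tofracM [FracField.tofrac d * _]mulrC mulrA E'.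
have vD' t : exists n, v t * FracField.tofrac D == FracField.tofrac n.
  by have [n ->] := vD t; exists n.
exists (fun t => xchoose (vD' t)); split.
  exists t0; rewrite -tofrac_eq0 -(eqP (xchooseP (vD' t0))) mulf_neq0 //.
  by rewrite tofrac_eq0.
move=> u; apply/eqP; rewrite -tofrac_eq0 rmorph_sum /=.
rewrite (eq_bigr (fun t => FracField.tofrac (A u t) * v t * FracField.tofrac D)).
  by rewrite -mulr_suml Av mul0r.
by move=> t _; rewrite rmorphM /= -(eqP (xchooseP (vD' t))) mulrA.
Qed.

Section Family.
Variable C : numFieldType.

Lemma poly_nonroot (p : {poly C}) : p != 0 -> exists e : C, p.[e] != 0.
Proof.
move=> p0; pose rs := [seq n%:R : C | n <- iota 0 (size p)].
have [/allP all_root|/allPn[e _ pe]] := boolP (all (root p) rs); last by exists e.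
have := max_poly_roots p0 (introT allP all_root); rewrite size_map size_iota ltnn.
by rewrite map_inj_uniq ?iota_uniq => [|i j /eqP]; [move/(_ isT)|rewrite eqr_nat => /eqP].
Qed.

Lemma saturate (T : finType) (w : T -> {poly C}) t0 : w t0 != 0 ->
  exists n (v : T -> {poly C}), (exists t, (v t).[0] != 0) /\ forall t, w t = 'X^n * v t.
Proof.
move: {2}(size (w t0)) (leqnn (size (w t0))) => n.
elim: n w => [|n IHn] w; first by rewrite leqn0 size_poly_eq0 => ->.
move=> wn w0; have [/existsP[t wt]|/existsPn w00] := boolP [exists t, (w t).[0] != 0].
  by exists 0%N, w; split; [exists t|move=> t1; rewrite mul1r].
have wE t : w t = 'X * drop_poly 1 (w t).
  rewrite {1}(at0_divX (w t)) /= /horner_eval.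
  by move: (w00 t); rewrite negbK => /eqP ->; rewrite add0r.
have [||k [v [v0 vE]]] := IHn (fun t => drop_poly 1 (w t)).
- by rewrite size_drop_poly; lia.
- by apply: contraNneq w0 => d0; rewrite wE d0 mulr0.
by exists k.+1, v; split => // t; rewrite wE vE exprS mulrA.
Qed.

(** Over the fraction field of C[e] the system is solvable: a nonzero maximal
minor would remain nonzero at some value of e.  Clearing denominators and
dividing by a power of e gives a solution with a nonzero value at 0. *)
Theorem solvable_limit (U T : finType) (A : U -> T -> {poly C}) :
  (forall e : C, solvable (fun u t => (A u t).[e])) ->
  exists v : T -> {poly C}, (exists t, (v t).[0] != 0) /\ forall u, \sum_t A u t * v t = 0.
Proof.
move=> solA; case: (solvable_or_minor (fun u t => FracField.tofrac (A u t))); last first.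
  move=> [g]; rewrite -(rmorph_minor (@FracField.tofrac _)) tofrac_eq0 => /poly_nonroot[e].
  rewrite -[_.[e]]/(horner_eval e _) (rmorph_minor (horner_eval e)).
  by rewrite (solvable_minor0 _ (solA e)) eqxx.
move=> /solvable_fraction[w [[t0 wt0] Aw]].
have [n [v [v0 wE]]] := saturate wt0; exists v; split => // u.
apply: (@mulfI _ 'X^n); first by rewrite expf_neq0 ?polyX_eq0.
rewrite mulr0 -[RHS](Aw u) mulr_sumr; apply: eq_bigr => t _.
by rewrite wE; ring.
Qed.
End Family.

(** * The linear conditions imposed by multiple points *)

Definition monos (d : nat) : finType := {n : 'I_d.+1 * 'I_d.+1 | (n.1 + n.2 <= d)%N}.

Definition conds r (m : 'I_r -> nat) : finType :=
  {c : 'I_r * ('I_(\sum_i m i) * 'I_(\sum_i m i)) | (c.2.1 + c.2.2 < m c.1)%N}.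

(** The row of (i, (a, b)) and the column of (n1, n2) hold the coefficient of
X^a Y^b in (x_i + X)^n1 (y_i + Y)^n2 z_i^(d - n1 - n2), multiplied by z_i.  The
extra factor z_i makes the condition void at the points on the line z = 0, where
the chart z <> 0 says nothing. *)
Definition cond_entry (K : comNzRingType) d r (m : 'I_r -> nat) (x y z : 'I_r -> K)
    (c : conds m) (n : monos d) : K :=
  let: (i, (a, b)) := val c in let: (n1, n2) := val n in
  ('C(n1, a) * 'C(n2, b))%N%:R * (x i ^+ (n1 - a) * y i ^+ (n2 - b) * z i ^+ (d - (n1 + n2)).+1).

Lemma conds_exist r (m : 'I_r -> nat) i a b : (a + b < m i)%N ->
  exists c : conds m, [/\ (val c).1 = i, (val c).2.1 = a :> nat & (val c).2.2 = b :> nat].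
Proof.
move=> ab; have mi : (m i <= \sum_i m i)%N by rewrite (bigD1 i) //= leq_addr.
have al : (a < \sum_i m i)%N by lia.
have bl : (b < \sum_i m i)%N by lia.
pose c := (i, (Ordinal al, Ordinal bl)).
have cP : (c.2.1 + c.2.2 < m c.1)%N by [].
by exists (Sub c cP); rewrite SubK.
Qed.

Lemma monos_exist d i j : (i + j <= d)%N ->
  exists t : monos d, (val t).1 = i :> nat /\ (val t).2 = j :> nat.
Proof.
move=> ij; have il : (i < d.+1)%N by lia.
have jl : (j < d.+1)%N by lia.
pose c := (Ordinal il, Ordinal jl); have cP : (c.1 + c.2 <= d)%N by [].
by exists (Sub c cP); rewrite SubK.
Qed.

Section Planar.
Variables (K : comNzRingType) (d : nat).

Definition planar (v : monos d -> K) : {poly {poly K}} :=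
  \sum_n (v n *: 'X^((val n).1))%:P * 'X^((val n).2).

Lemma coef_planar v i j :
  (planar v)`_j`_i = \sum_(n : monos d | ((val n).1 == i :> nat) && ((val n).2 == j :> nat)) v n.
Proof.
rewrite /planar !coef_sum [RHS]big_mkcond; apply: eq_bigr => n _.
rewrite coefCM coefXn !(eq_sym _ (nat_of_ord _)).
case: (_ == j); rewrite ?andbF ?mulr0 ?coef0 // mulr1 coefZ coefXn (eq_sym i).
by case: (_ == i); rewrite ?mulr1 ?mulr0.
Qed.

Lemma coef_planar_mono v (n : monos d) : (planar v)`_((val n).2)`_((val n).1) = v n.
Proof.
by rewrite coef_planar (big_pred1 n).
Qed.

Lemma tdeg_lt_planar v : tdeg_lt d.+1 (planar v).
Proof.
move=> j; apply/leq_sizeP => i ij; rewrite coef_planar big1 // => n /andP[/eqP e1 /eqP e2].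
by have := valP n; rewrite /= e1 e2; move: ij; rewrite leqNgt; lia.
Qed.

Lemma coef_translate_planar v x y a b :
  (translate x y (planar v))`_b`_a =
  \sum_(n : monos d) ('C((val n).1, a) * 'C((val n).2, b))%N%:R *
    (x ^+ ((val n).1 - a) * y ^+ ((val n).2 - b)) * v n.
Proof.
rewrite /translate /planar !rmorph_sum /= !coef_sum; apply: eq_bigr => n _.
rewrite !rmorphM /= map_polyC map_polyXn /= comp_polyC rmorphXn /= comp_polyX.
rewrite coefCM coef_XaddC_exp comp_polyZ rmorphXn /= comp_polyX.
rewrite -polyC_exp -polyCMn mulrC mul_polyC !coefZ coef_XaddC_exp.
rewrite -[x ^+ _ *+ _]mulr_natr -[y ^+ _ *+ _]mulr_natr; ring.
Qed.
End Planar.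

Definition affine_solvable (K : comNzRingType) d r (m : 'I_r -> nat) (x y : 'I_r -> K) :=
  solvable (fun (c : conds m) (n : monos d) => cond_entry x y (fun=> 1) c n).

Section Family.
Variables (C : numFieldType) (d r : nat) (m : 'I_r -> nat).
Hypothesis solv : forall x y : 'I_r -> C, affine_solvable d m x y.

Lemma family_of_curves (x y : 'I_r -> {poly C}) :
  exists F : {poly {poly {poly C}}}, [/\ tdeg_lt d.+1 F,
    map_poly (map_poly (at0 C)) F != 0 & forall i, mult_ge F (x i) (y i) (m i)].
Proof.
have [e|v [[n vn0] Av]] := @solvable_limit C _ _
    (fun (c : conds m) (n : monos d) => cond_entry x y (fun=> 1) c n).
  have [v [v0 Av]] := solv (fun i => (x i).[e]) (fun i => (y i).[e]).
  exists v; split => // c; rewrite -[RHS](Av c); apply: eq_bigr => n _; congr (_ * _).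
  rewrite /cond_entry; case: (val c) => i [a b]; case: (val n) => n1 n2.
  by rewrite !hornerE -!polyC_natr !hornerE ?expr1n ?hornerE.
exists (planar v); split; first exact: tdeg_lt_planar.
  apply: contraNneq vn0 => E.
  have := congr1 (fun p : {poly {poly C}} => p`_((val n).2)`_((val n).1)) E.
  by rewrite /= !coef_map /= coef_planar_mono !coef0 => E0; apply/eqP.
move=> i a b ab; rewrite coef_translate_planar.
have [c [c1 c2 c3]] := conds_exist ab; rewrite -[RHS](Av c); apply: eq_bigr => n' _.
congr (_ * _); rewrite /cond_entry; move: c1 c2 c3; case: (val c) => i' [a' b'] /= -> -> ->.
by case: (val n') => n1 n2 /=; rewrite expr1n mulr1.
Qed.

Lemma family_along_curve (xi : {poly {poly C}}) (x : 'I_r -> {poly C}) : injective x ->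
  exists F : {poly {poly {poly C}}}, [/\ tdeg_lt d.+1 F,
    map_poly (map_poly (at0 C)) F != 0 &
    forall j, exists q, (F \Po ('X + xi%:P))`_j =
      q * \prod_(i <- enum 'I_r) ('X - (x i)%:P) ^+ (m i - j)].
Proof.
move=> xI; have [F [PF F0 Fm]] := family_of_curves x (fun i => xi.[x i]).
exists F; split => // j; apply: dvd_prod_XsubC_exp => // [|i _]; first exact: enum_uniq.
exact: dvd_along_curve.
Qed.

(** The points (i e, xi(i e)) collide at e = 0 along the germ y = xi(x), and
prod_i (x - i e)^(m_i - j) becomes x^(sum_i (m_i - j)), where
sum_i (m_i - j) >= sum_i m_i - r j. *)
Lemma specialize_to_germ (xi : {poly C}) :
  exists f : {poly {poly C}}, [/\ tdeg_lt d.+1 f, f != 0 &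
    forall i j, (i + r * j < \sum_i m i)%N -> (f \Po ('X + xi%:P))`_j`_i = 0].
Proof.
have [|F [PF F0 Fd]] := @family_along_curve (map_poly polyC xi) (fun i => i%:R *: 'X).
  move=> i j /(congr1 (fun p : {poly C} => p`_1)).
  by rewrite !coefZ coefX !mulr1 => /eqP; rewrite eqr_nat => /eqP/val_inj.
exists (map_poly (map_poly (at0 C)) F); split => //.
  by apply: tdeg_lt_map PF => p; apply: size_poly.
move=> i j ij; have [q qE] := Fd j; have := congr1 (map_poly (at0 C)) qE.
rewrite rmorphM /= rmorph_prod /= -(coef_map (map_poly (at0 C))) map_comp_poly.
rewrite rmorphD /= map_polyX map_polyC /= map_at0C => ->.
under eq_bigr do rewrite rmorphXn rmorphB /= map_polyX map_polyC /= /horner_eval !hornerE subr0.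
rewrite big_enum /= -expr_sum coefMXn ifT //.
have : (\sum_i m i <= \sum_i (m i - j) + \sum_(i < r) j)%N.
  by rewrite -big_split; apply: leq_sum => k _ /=; lia.
rewrite sum_nat_const card_ord [in (_ < _)%N](eq_bigl xpredT) //; move: ij.
by move: (\sum_i m i)%N (\sum_i (m i - j))%N (r * j)%N => a b c; lia.
Qed.
End Family.

Lemma square_not_all_solvable (C : numFieldType) s d (m : 'I_(s * s) -> nat) :
  (4 <= s)%N -> (0 < d)%N -> (s * d <= \sum_i m i)%N ->
  ~ forall x y : 'I_(s * s) -> C, affine_solvable d m x y.
Proof.
move=> s4 d0 dm solv.
have [|F [PF F0 Fd]] := @family_along_curve C d _ m solv
   ('X^s + 'X%:P * 'X^(s * s - 2)) (fun i => (i.+1%:R)%:P).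
  by move=> i j /polyC_inj/eqP; rewrite eqr_nat eqSS => /eqP/val_inj.
apply: (no_special_family s4 PF F0 d0 dm) => j; have [q qE] := Fd j.
exists q; rewrite qE; congr (_ * _); rewrite /nodes rmorph_prod /=; apply: eq_bigr => i _.
by rewrite rmorphXn rmorphB /= map_polyX map_polyC.
Qed.

(** * Multivariate polynomials as polynomials in y over polynomials in x *)

Lemma eq_mnm2 (m : multinom 2) a b :
  (m == Multinom [tuple a; b]) = ((m 0 : nat) == a) && ((m 1 : nat) == b).
Proof.
apply/eqP/andP => [->|[/eqP e0 /eqP e1]]; first by [].
apply/mnmP => i; rewrite multinomE (tnth_nth 0%N).
by case: i => -[|[|//]] ilt /=; [rewrite -e0|rewrite -e1]; congr (m _); apply: val_inj.
Qed.

Lemma eq_mnm3 (m : multinom 3) a b c :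
  (m == Multinom [tuple a; b; c]) =
  [&& (m 0 : nat) == a, (m 1 : nat) == b & (m 2%:R : nat) == c].
Proof.
apply/eqP/and3P => [->|[/eqP e0 /eqP e1 /eqP e2]]; first by [].
apply/mnmP => i; rewrite multinomE (tnth_nth 0%N).
by case: i => -[|[|[|//]]] ilt /=; [rewrite -e0|rewrite -e1|rewrite -e2];
  congr (m _); apply: val_inj.
Qed.

Section Psi.
Variable K : comNzRingType.

Definition scalar : {rmorphism K -> {poly {poly K}}} := (polyC \o polyC).

(** The ring isomorphism C[x, y] -> C[x][y]. *)
Definition bipoly : {rmorphism {mpoly K[2]} -> {poly {poly K}}} :=
  mmap scalar (fun i : 'I_2 => if i == 0 then 'X%:P else 'X).

(** Killing the third variable loses nothing on equations in the chart z <> 0,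
in which that variable does not occur. *)
Definition bipoly_z0 : {rmorphism {mpoly K[3]} -> {poly {poly K}}} :=
  mmap scalar (fun i : 'I_3 => if i == 0 then 'X%:P else if i == 1 then 'X else 0).

Arguments bipoly : simpl never.
Arguments bipoly_z0 : simpl never.

Lemma bipolyC c : bipoly (mpolyC 2 c) = (c%:P)%:P.
Proof. by rewrite [LHS]mmapC. Qed.
Lemma bipoly_z0C c : bipoly_z0 (mpolyC 3 c) = (c%:P)%:P.
Proof. by rewrite [LHS]mmapC. Qed.
Lemma bipolyX m : bipoly (mpolyX K m) = ('X^(m 0))%:P * 'X^(m 1).
Proof.
rewrite [LHS]mmapX /mmap1 !big_ord_recl big_ord0 /= mulr1 -polyC_exp.
by congr (('X^(m _))%:P * 'X^(m _)); apply: val_inj.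
Qed.
Lemma bipoly_z0X m : bipoly_z0 (mpolyX K m) = ('X^(m 0))%:P * 'X^(m 1) * 0 ^+ (m 2%:R).
Proof.
rewrite [LHS]mmapX /mmap1 !big_ord_recl big_ord0 /= mulr1 -polyC_exp mulrA.
by congr (('X^(m _))%:P * 'X^(m _) * 0 ^+ (m _)); apply: val_inj.
Qed.

Lemma coef_bipoly f a b : (bipoly f)`_b`_a = mcoeff (Multinom [tuple a; b]) f.
Proof.
rewrite {1}[f]mpolyE [in RHS](mpolyE f) !raddf_sum /= !coef_sum; apply: eq_bigr => m _.
rewrite mcoeffZ mcoeffX eq_mnm2 -mul_mpolyC (rmorphM bipoly) bipolyC bipolyX.
rewrite !coefCM coefXn !(eq_sym _ (m _)).
by case: (_ == b); rewrite ?andbF ?andbT ?mulr0 ?coef0 ?mulr0 // mulr1 coefXn eq_sym.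
Qed.

Lemma coef_bipoly_z0 f a b : (bipoly_z0 f)`_b`_a = mcoeff (Multinom [tuple a; b; 0%N]) f.
Proof.
rewrite {1}[f]mpolyE [in RHS](mpolyE f) !raddf_sum /= !coef_sum; apply: eq_bigr => m _.
rewrite mcoeffZ mcoeffX eq_mnm3 -mul_mpolyC (rmorphM bipoly_z0) bipoly_z0C bipoly_z0X expr0n.
rewrite !coefCM -mulrA coefCM mulr_natr coefMn coefXn !(eq_sym _ (m _)).
case: (_ == b); case: (_ == 0%N); rewrite ?andbF ?andbT ?mul0rn ?mulr0 ?coef0 ?mulr0 //.
by rewrite mulr1 coefXn eq_sym.
Qed.
End Psi.

Arguments bipoly : simpl never.
Arguments bipoly_z0 : simpl never.

Notation ix := (0%R : 'I_3).
Notation iy := (1%R : 'I_3).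
Notation iz := (2%:R%R : 'I_3).

Definition mono3 d (n : monos d) : multinom 3 :=
  Multinom [tuple ((val n).1 : nat); ((val n).2 : nat); (d - ((val n).1 + (val n).2))%N].

Lemma mdeg3 (m : multinom 3) : mdeg m = (m 0%R + m 1%R + m 2%:R)%N.
Proof.
rewrite mdegE !big_ord_recl big_ord0 addn0 addnA.
by congr (m _ + m _ + m _)%N; apply: val_inj.
Qed.

Section Forms.
Variable R : realType.
Notation K := (CC R).

Lemma form_expand d (F : {mpoly K[3]}) : F \is ishomog1 d mdeg ->
  F = \sum_(n : monos d) mcoeff (mono3 n) F *: mpolyX K (mono3 n).
Proof.
move=> homF; apply/mpolyP => m; rewrite raddf_sum /=.
have [dm|dm] := eqVneq (mdeg m) d.
  have [|n [n1 n2]] := @monos_exist d (m 0) (m 1); first by rewrite -dm mdeg3; lia.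
  have mE : mono3 n = m.
    apply/esym/eqP; rewrite eq_mnm3 n1 n2 !eqxx /= -dm mdeg3; apply/eqP; lia.
  rewrite (bigD1 n) //= mE mcoeffZ mcoeffX eqxx mulr1 big1 ?addr0 // => n' n'n.
  rewrite mcoeffZ mcoeffX [_ == m](_ : _ = false) ?mulr0 //.
  apply: contraNF n'n; rewrite -mE => /eqP/mnmP E; apply/eqP.
  have := E 0; have := E 1; rewrite !multinomE !(tnth_nth 0%N) /= => e2 e1.
  apply: val_inj; rewrite [LHS]surjective_pairing [RHS]surjective_pairing.
  by congr (_, _); apply: val_inj.
rewrite big1 => [|n _].
  exact: dhomog_nemf_coeff homF dm.
rewrite mcoeffZ mcoeffX [_ == m](_ : _ = false) ?mulr0 //.
apply: contraNF dm => /eqP <-; rewrite mdeg3 !multinomE !(tnth_nth 0%N) /=.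
by have := valP n; move=> /= ?; apply/eqP; lia.
Qed.

Lemma coef_local_equationX (p : 'rV[K]_3) m a b :
  (bipoly_z0 _ (local_equation (mpolyX K m) p iz))`_b`_a =
  ('C(m ix, a) * 'C(m iy, b))%N%:R * (p 0 ix ^+ (m ix - a) * p 0 iy ^+ (m iy - b) * p 0 iz ^+ m iz).
Proof.
rewrite /local_equation comp_mpolyX !big_ord_recl big_ord0 !tnth_mktuple /= mulr1.
have -> : lift ord0 (ord0 : 'I_2) = 1 :> 'I_3 by apply: val_inj.
have -> : lift ord0 (lift ord0 (ord0 : 'I_1)) = 2%:R :> 'I_3 by apply: val_inj.
have -> : ord0 = 0 :> 'I_3 by apply: val_inj.
rewrite /= addr0 !rmorphM !rmorphXn !rmorphD /= !bipoly_z0C !bipoly_z0X.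
have U i j : fun_of_multinom (mnm1 (i : 'I_3)) j = (i == j) :> nat by rewrite mnm1E.
rewrite !U /= !expr0 !expr1 !mulr1 polyC1 mul1r.
rewrite -polyCD addrC -polyC_exp [(p 0 1)%:P%:P + _]addrC coefCM.
rewrite -!polyC_exp mulrC.
rewrite !coefMC !coef_XaddC_exp.
rewrite -!polyC_exp -polyCMn -polyCM coefCM coef_XaddC_exp.
rewrite -[p 0 1 ^+ _ *+ _]mulr_natr -[p 0 0 ^+ _ *+ _]mulr_natr; ring.
Qed.

Lemma bipoly_z0_local_equation_sum (I : finType) (v : I -> K) (M : I -> multinom 3)
    (p : 'rV[K]_3) k :
  bipoly_z0 _ (local_equation (\sum_n v n *: mpolyX K (M n)) p k) =
  \sum_n (v n)%:P%:P * bipoly_z0 _ (local_equation (mpolyX K (M n)) p k).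
Proof.
rewrite /local_equation; set lq := [tuple _ | _ < _].
pose L : {additive {mpoly K[3]} -> {mpoly K[3]}} := comp_mpoly lq.
rewrite (raddf_sum L) (raddf_sum (bipoly_z0 _)); apply: eq_bigr => n _.
by rewrite /L /= comp_mpolyZ -mul_mpolyC [LHS](rmorphM (bipoly_z0 _)) bipoly_z0C.
Qed.

(** The solution is the vector of coefficients of F: the rows at a point with
z = 0 vanish, and the others express the multiplicity in the chart z <> 0. *)
Lemma form_solvable r (P : 'M[K]_(r, 3)) d (F : {mpoly K[3]}) (m : 'I_r -> nat) :
  F != 0 -> F \is ishomog1 d mdeg -> (forall i, multiplicity_ge F (row i P) (m i)) ->
  solvable (@cond_entry K d r m (fun i => P i ix) (fun i => P i iy) (fun i => P i iz)).
Proof.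
move=> F0 homF Fm; exists (fun n => mcoeff (mono3 n) F); split.
  apply/existsP; apply: contraNT F0 => /existsPn v0; apply/eqP.
  rewrite (form_expand homF) big1 // => n _.
  by move: (v0 n); rewrite negbK => /eqP ->; rewrite scale0r.
move=> c; rewrite /cond_entry; have := valP c; case: (val c) => i [a b] /= ab.
have [z0|z0] := eqVneq (P i iz) 0.
  by apply: big1 => n _; case: (val n) => n1 n2; rewrite z0 exprS mul0r !mulr0 mul0r.
have := Fm i iz; rewrite mxE => /(_ z0 (Multinom [tuple (a : nat); (b : nat); 0%N])).
rewrite mdeg3 !multinomE !(tnth_nth 0%N) /= addn0 => /(_ ab).
rewrite -coef_bipoly_z0 [X in local_equation X](form_expand homF).
rewrite bipoly_z0_local_equation_sum !coef_sum => E.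
transitivity (P i iz * 0); last by rewrite mulr0.
rewrite -[X in _ = _ * X]E mulr_sumr; apply: eq_bigr => n _; rewrite !coefCM.
rewrite (coef_local_equationX (row i P)) !mxE.
rewrite !multinomE !(tnth_nth 0%N) /=; case: (val n) => n1 n2 /=.
by rewrite exprS; ring.
Qed.
End Forms.

(** * Configurations with a special curve form a proper closed set *)

Section Multihomogeneous.
Variables (R : realType) (r : nat).
Notation K := (CC R).
Notation MP := {mpoly K[r * 3]}.

Definition has_multidegree (D : 'I_r -> nat) (F : MP) : Prop :=
  forall m, m \in msupp F -> forall i, (\sum_(j < 3) (m : multinom _) (mxvec_index i j) = D i)%N.

Lemma has_multidegree0 D : has_multidegree D 0.
Proof. by move=> m; rewrite msupp0. Qed.

Lemma has_multidegreeD D F G :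
  has_multidegree D F -> has_multidegree D G -> has_multidegree D (F + G).
Proof. by move=> HF HG m /msuppD_le; rewrite mem_cat => /orP[/HF|/HG]. Qed.

Lemma has_multidegreeM D E F G : has_multidegree D F -> has_multidegree E G ->
  has_multidegree (fun i => D i + E i)%N (F * G).
Proof.
move=> HF HG m /msuppM_le/allpairsP[[m1 m2] /= [/HF H1 /HG H2 ->]] i.
by rewrite -H1 -H2 -big_split; apply: eq_bigr => j _; rewrite mnmDE.
Qed.

Lemma has_multidegreeC c : has_multidegree (fun=> 0%N) (mpolyC _ c : MP).
Proof.
move=> m; rewrite msuppC; case: ifP => // _; rewrite inE => /eqP -> i.
by apply: big1 => j _; rewrite mnm0E.
Qed.

Arguments has_multidegreeC : clear implicits.

Lemma has_multidegreeX D F n : has_multidegree D F ->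
  has_multidegree (fun i => n * D i)%N (F ^+ n).
Proof.
move=> HF; elim: n => [|n IHn]; first by rewrite expr0 -mpolyC1; exact: (has_multidegreeC 1).
rewrite exprS => m Fm i; rewrite mulSn; exact: (has_multidegreeM HF IHn).
Qed.

Lemma has_multidegree_prod (I : Type) (s : seq I) (D : I -> 'I_r -> nat) (F : I -> MP) :
  (forall k, has_multidegree (D k) (F k)) ->
  has_multidegree (fun i => \sum_(k <- s) D k i)%N (\prod_(k <- s) F k).
Proof.
move=> HF; elim: s => [|k s IHs].
  by move=> m; rewrite big_nil -mpolyC1 => /(has_multidegreeC 1) H i; rewrite big_nil.
move=> m; rewrite big_cons => /(has_multidegreeM (HF k) IHs) H i.
by rewrite big_cons.
Qed.

Definition coord (i : 'I_r) (j : 'I_3) : MP := mpolyX K (mnm1 (mxvec_index i j)).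

Lemma has_multidegree_coord i j : has_multidegree (fun i' => i' == i) (coord i j).
Proof.
move=> m; rewrite msuppX inE => /eqP -> i'.
under eq_bigr do rewrite mnm1E.
have E j' : (mxvec_index i j == mxvec_index i' j') = (i' == i) && (j' == j).
  apply/eqP/andP => [|[/eqP -> /eqP ->] //].
  by rewrite /mxvec_index => /cast_ord_inj/enum_rank_inj[-> ->].
rewrite (bigD1 j) //= E eqxx andbT big1 ?addn0 // => j' j'j.
by rewrite E (negPf j'j) andbF.
Qed.

Arguments has_multidegree_coord : clear implicits.

(** The multidegree depends only on the row, so it is the same for all terms of
the expansion of a minor. *)
Lemma has_multidegree_entry d (m : 'I_r -> nat) (c : conds m) : exists D, forall n : monos d,
  has_multidegree D
    (cond_entry (fun i => coord i ix) (fun i => coord i iy) (fun i => coord i iz) c n).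
Proof.
rewrite /cond_entry; case: (val c) => i [a b].
exists (fun i' => (i' == i) * (d - (a + b)).+1)%N => n.
case: (val n) (valP n) => n1 n2 /= nd.
have [an|an] := leqP a n1; last by rewrite bin_small // mul0n mul0r; exact: has_multidegree0.
have [bn|bn] := leqP b n2; last by rewrite (bin_small bn) muln0 mul0r; exact: has_multidegree0.
rewrite -mpolyC_nat => q qs i'.
rewrite (has_multidegreeM (has_multidegreeC _) (has_multidegreeM (has_multidegreeM
  (has_multidegreeX (has_multidegree_coord _ _)) (has_multidegreeX (has_multidegree_coord _ _)))
  (has_multidegreeX (has_multidegree_coord _ _))) qs).
case: (i' == i); rewrite ?muln0 ?muln1 // mul1n add0n.
move: nd an bn; clear.
move: (nat_of_ord n1) (nat_of_ord n2) (nat_of_ord a) (nat_of_ord b) => p1 p2 p3 p4; lia.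
Qed.

Lemma minor_multihomogeneous d (m : 'I_r -> nat) g : multihomogeneous
  (minor (fun (c : conds m) (n : monos d) =>
    cond_entry (fun i => coord i ix) (fun i => coord i iy) (fun i => coord i iz) c n) g).
Proof.
have [D HD] := choice (@has_multidegree_entry d m).
exists (fun i => \sum_(k <- enum 'I_#|monos d|) D (g k) i)%N; rewrite -/(has_multidegree _ _).
rewrite /minor /determinant; apply: (big_ind (has_multidegree _)).
- exact: has_multidegree0.
- exact: has_multidegreeD.
have sgE (b : bool) : (-1) ^+ b = mpolyC _ ((-1) ^+ b) :> MP by rewrite rmorph_sign.
move=> s _; rewrite sgE.
move=> q qs i; rewrite -big_enum in qs.
apply: etrans (has_multidegreeM (has_multidegreeC _)
  (has_multidegree_prod (D := D \o g) _) qs i) _ => //.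
by move=> k; rewrite mxE; apply: HD.
Qed.

End Multihomogeneous.

Section Points.
Open Scope classical_set_scope.
Open Scope ring_scope.
Variables (R : realType) (r : nat).
Notation K := (CC R).

(** A configuration at which the linear system has no solution provides a
maximal minor that is nonzero there and vanishes at all the configurations
carrying a curve. *)
Lemma closed_special_configurations d (m : 'I_r -> nat) (x y : 'I_r -> K) :
  ~ affine_solvable d m x y ->
  exists Z : set 'M[K]_(r, 3), proper_closed_configurations Z /\
    forall P (F : {mpoly K[3]}), F != 0 -> F \is ishomog1 d mdeg ->
      (forall i, multiplicity_ge F (row i P) (m i)) -> Z P.
Proof.
move=> nsol; have [//|[g gn]] := solvable_or_minor
  (fun (c : conds m) (n : monos d) => cond_entry x y (fun=> 1) c n).
pose G : {mpoly K[r * 3]} := minor (fun (c : conds m) (n : monos d) =>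
    cond_entry (fun i => coord R i ix) (fun i => coord R i iy) (fun i => coord R i iz) c n) g.
have GE (P : 'M[K]_(r, 3)) : meval (fun k => mxvec P 0 k) G =
    minor (fun (c : conds m) (n : monos d) =>
      cond_entry (fun i => P i ix) (fun i => P i iy) (fun i => P i iz) c n) g.
  rewrite [LHS](rmorph_minor (meval (fun k => mxvec P 0 k))); congr (\det _).
  apply/matrixP => i j; rewrite !mxE /cond_entry.
  case: (val (g i)) => k [a b]; case: (val _) => n1 n2.
  by rewrite !rmorphM !rmorphXn /= !rmorph_nat /coord !mevalXU !mxvecE.
exists [set P | meval (fun k => mxvec P 0 k) G = 0]; split.
  split.
    exists [set G]; split; first by move=> _ ->; exact: minor_multihomogeneous.
    by move=> P _; split=> [GP _ ->|/(_ G erefl)].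
  exists (\matrix_(i, j) if j == ix then x i else if j == iy then y i else 1); split.
    move=> i; apply/eqP => /rowP/(_ iz); rewrite !mxE /= => /eqP; by rewrite oner_eq0.
  apply/eqP; rewrite GE; apply: contraNneq gn => <-; apply/eqP; congr (\det _).
  apply/matrixP => i j; rewrite !mxE /cond_entry.
  by case: (val (g i)) => k [a b]; case: (val _) => n1 n2; rewrite !mxE.
move=> P F F0 homF Fm /=; rewrite GE; apply: solvable_minor0; exact: form_solvable homF Fm.
Qed.

Lemma empty_proper_closed : proper_closed_configurations (set0 : set 'M[K]_(r, 3)).
Proof.
split; last first.
  exists (const_mx 1); split => // i; apply/eqP => /rowP/(_ 0).
  by rewrite !mxE => /eqP; rewrite oner_eq0.
exists [set 1]; split; last by move=> P _; split => // /(_ 1 erefl)/eqP; rewrite meval1 oner_eq0.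
by move=> _ ->; exists (fun=> 0%N); rewrite -mpolyC1; exact: (@has_multidegreeC R r 1).
Qed.

Lemma for_very_general_points_no_curve (bad : nat -> ('I_r -> nat) -> Prop) :
  (forall d m, bad d m -> exists x y : 'I_r -> K, ~ affine_solvable d m x y) ->
  for_very_general_points (fun P : 'M[K]_(r, 3) => forall d (F : {mpoly K[3]}) m,
    F != 0 -> F \is ishomog1 d mdeg -> (forall i, multiplicity_ge F (row i P) (m i)) ->
    ~ bad d m).
Proof.
move=> badP.
have /choice[Z ZP] (k : nat) : exists Z : set 'M[K]_(r, 3), proper_closed_configurations Z /\
   forall P d (F : {mpoly K[3]}) (m : 'I_r -> nat), pickle (d, [ffun i => m i]) = k -> bad d m ->
     F != 0 -> F \is ishomog1 d mdeg -> (forall i, multiplicity_ge F (row i P) (m i)) -> Z P.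
  have [[[d m] [<- /badP[x [y nsol]]]]|nobad] := pselect
    (exists dm : nat * {ffun 'I_r -> nat}, pickle dm = k /\ bad dm.1 dm.2).
    have [Z [ZP ZF]] := closed_special_configurations nsol.
    exists Z; split => // P d' F m' /(pcan_inj pickleK)[-> mE] _ F0 homF Fm.
    apply: (ZF P F) => // i.
    by rewrite -mE ffunE.
  exists set0; split; first exact: empty_proper_closed.
  move=> P d F m kE bdm; case: nobad; exists (d, [ffun i => m i]); split => //=.
  suff -> : ([ffun i => m i] : 'I_r -> nat) = m by [].
  by apply/funext => i; rewrite ffunE.
exists Z; split => [k|P _ ZnP d F m F0 homF Fm bdm]; first by case: (ZP k).
by have [_ /(_ P d F m erefl bdm F0 homF Fm)] := ZP (pickle (d, [ffun i => m i])); apply: ZnP.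
Qed.
End Points.

(** * Quasimonomial valuations *)

Section Weight.
Variables (A : nzRingType) (r : nat).

Definition weight_ge (M : nat) (f : {poly {poly A}}) : Prop :=
  forall i j, (i + r * j < M)%N -> f`_j`_i = 0.

Lemma weight_geM M N f g : weight_ge M f -> weight_ge N g -> weight_ge (M + N) (f * g).
Proof.
move=> Mf Ng i j ij; rewrite coefM coef_sum big1 // => -[b /= jb] _.
rewrite coefM big1 // => -[a /= ia] _.
have jE : (r * j = r * b + r * (j - b))%N by rewrite -mulnDr; congr (_ * _)%N; lia.
case: (ltnP (a + r * b) M) => ab; first by rewrite (Mf _ _ ab) mul0r.
by rewrite (Ng (i - a)%N (j - b)%N) ?mulr0 //; lia.
Qed.

Lemma weight_geX M f k : weight_ge M f -> weight_ge (k * M) (f ^+ k).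
Proof.
move=> Mf; elim: k => [|k IHk]; first by move=> i j; rewrite mul0n.
by rewrite exprS mulSn; apply: weight_geM.
Qed.
End Weight.

Section Expansion.
Variable R : realType.
Notation K := (CC R).

Definition truncation (xi : nat -> K) n : {poly K} := \poly_(k < n.+1) xi k.

Lemma bipoly_trunc xi n : bipoly _ (series_trunc xi n) = (truncation xi n)%:P.
Proof.
rewrite /series_trunc (raddf_sum (bipoly K)) /truncation poly_def [RHS]raddf_sum.
apply: eq_bigr => k _.
rewrite [LHS](rmorphM (bipoly K)) [bipoly K (_ ^+ k)](rmorphXn (bipoly K)) bipolyC.
rewrite /varx bipolyX !mnm1E /= !expr1 expr0 mulr1.
by rewrite -polyC_exp -polyCM mul_polyC.
Qed.

Lemma bipoly_comp (q : {mpoly K[2]}) p (f : {mpoly K[2]}) : bipoly _ q = p%:P ->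
  bipoly _ (comp_mpoly [tuple varx R; vary R + q] f) = bipoly _ f \Po ('X + p%:P).
Proof.
move=> qp.
pose L : {rmorphism {mpoly K[2]} -> {mpoly K[2]}} := comp_mpoly [tuple varx R; vary R + q].
rewrite -[comp_mpoly _ f]/(L f) [f]mpolyE (raddf_sum L) !(raddf_sum (bipoly K)).
rewrite (raddf_sum (comp_poly _)); apply: eq_bigr => m _.
rewrite -mul_mpolyC [X in bipoly K X = _](rmorphM L).
rewrite [LHS](rmorphM (bipoly K)) /= comp_mpolyC !bipolyC.
rewrite [bipoly K _ in RHS](rmorphM (bipoly K)) bipolyC comp_polyM comp_polyC; congr (_ * _).
rewrite bipolyX comp_polyM comp_polyC [_ \Po _ in RHS]rmorphXn /= comp_polyX -qp.
rewrite [comp_mpoly _ _]comp_mpolyX !big_ord_recl big_ord0 mulr1.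
rewrite !(tnth_nth 0) /= (rmorphM (bipoly K)) !(rmorphXn (bipoly K)) (rmorphD (bipoly K)).
rewrite /varx /vary !bipolyX !mnm1E /= !expr1 !expr0 mulr1 polyC1 mul1r -polyC_exp.
by congr (('X^(m _))%:P * (_ + _) ^+ (m _)); apply: val_inj.
Qed.

(** Higher truncations of xi do not change the coefficient, so the same one can
serve for all powers of f. *)
Lemma expansion_coefE xi f i j n : (i <= n)%N ->
  expansion_coef xi f i j = (bipoly _ f \Po ('X + (truncation xi n)%:P))`_j`_i.
Proof.
move=> le_in; rewrite /expansion_coef -coef_bipoly (bipoly_comp _ (bipoly_trunc xi i)).
have [h hE] : exists h : {poly K}, truncation xi n = truncation xi i + h * 'X^(i.+1).
  exists (drop_poly i.+1 (truncation xi n)).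
  rewrite -[LHS](poly_take_drop i.+1); congr (_ + _).
  apply/polyP => k; rewrite coef_take_poly !coef_poly.
  by case: ltnP => // ki; rewrite (leq_trans ki).
rewrite hE polyCD addrA.
have [S ->] := comp_poly_taylor1 (bipoly K f) ('X + (truncation xi i)%:P) (h * 'X^(i.+1))%:P.
by rewrite coefD coefMC coefD mulrA coefMXn ltnSn addr0.
Qed.

Lemma mdeg2 (m : multinom 2) : mdeg m = (m 0%R + m 1%R)%N.
Proof.
rewrite mdegE !big_ord_recl big_ord0 addn0.
by congr (m _ + m _)%N; apply: val_inj.
Qed.

Lemma bipoly_neq0 f : (bipoly K f != 0) = (f != 0).
Proof.
apply/idP/idP; first by apply: contraNneq => ->; rewrite (raddf0 (bipoly K)).
apply: contraNneq => f0.
apply/eqP/mpolyP => m; rewrite mcoeff0.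
have -> : m = Multinom [tuple (m 0%R : nat); (m 1%R : nat)].
  by apply/eqP; rewrite eq_mnm2 !eqxx.
by rewrite -coef_bipoly f0 !coef0.
Qed.

Lemma bipoly_surj d (f : {poly {poly K}}) : tdeg_lt d.+1 f ->
  exists2 g : {mpoly K[2]}, bipoly K g = f & (msize g <= d.+1)%N.
Proof.
move=> Pf; pose v (n : monos d) := f`_(val n).2`_(val n).1.
pose mono2 (n : monos d) : multinom 2 := Multinom [tuple ((val n).1 : nat); ((val n).2 : nat)].
exists (\sum_n v n *: mpolyX K (mono2 n)).
  rewrite (raddf_sum (bipoly K)); have -> : f = planar v.
    apply/polyP => j; apply/polyP => i; rewrite coef_planar.
    have [ij|ij] := leqP (i + j) d.
      have [n [n1 n2]] := monos_exist ij; rewrite -n1 -n2 (big_pred1 n) //.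
    rewrite big1 => [|n /andP[/eqP e1 /eqP e2]].
      by apply: nth_default; apply: leq_trans (Pf j) _; lia.
    by have := valP n; rewrite /= e1 e2; lia.
  apply: eq_bigr => n _; rewrite -mul_mpolyC [LHS](rmorphM (bipoly K)) bipolyC bipolyX.
  by rewrite !multinomE !(tnth_nth 0%N) /= mulrA -mul_polyC polyCM.
apply: leq_trans (msize_sum _ _ _) _; apply/bigmax_leqP => n _.
apply: leq_trans (msizeZ_le _ _) _; rewrite msizeX mdeg2 !multinomE !(tnth_nth 0%N) /=.
by have := valP n.
Qed.

End Expansion.

Section Qmval.
Open Scope classical_set_scope.
Open Scope ring_scope.
Variable R : realType.
Notation K := (CC R).
Implicit Types (xi : nat -> K) (t : R) (f : {mpoly K[2]}).

(** The substitution y -> y + xi(x) keeps the leading coefficient of f in y,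
which is a polynomial in x of degree at most d.  This bounds the valuation, so
that the supremum defining [mu] is a genuine one. *)
Lemma expansion_coef_top xi f d : f != 0 -> (msize f <= d.+1)%N ->
  exists i j, [/\ (i <= d)%N, (j <= d)%N & expansion_coef xi f i j != 0].
Proof.
move=> f0 fd; have p0 : bipoly K f != 0 by rewrite bipoly_neq0.
pose j := (size (bipoly K f)).-1; pose i := (size (bipoly K f)`_j).-1.
have cij : (bipoly K f)`_j`_i != 0 by rewrite -!/(lead_coef _) !lead_coef_eq0.
have topE : (bipoly K f \Po ('X + (truncation xi i)%:P))`_j = (bipoly K f)`_j.
  have sX : size ('X + (truncation xi i)%:P) = 2 by exact: size_XaddC.
  rewrite -[RHS]/(lead_coef _) /j -(size_comp_poly2 (bipoly K f) sX) -/(lead_coef _).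
  by rewrite lead_coef_comp ?sX // lead_coefXaddC expr1n mulr1.
have ij : (i + j <= d)%N.
  rewrite -ltnS; apply: leq_trans fd; move: cij; rewrite coef_bipoly -mcoeff_msupp.
  by move=> /msize_mdeg_lt; rewrite mdeg2 !multinomE !(tnth_nth 0%N).
exists i, j; split; [lia|lia|].
by rewrite (expansion_coefE _ _ _ (leqnn i)) topE.
Qed.

Lemma qmval_ge xi t M f : f != 0 ->
  (forall i j, expansion_coef xi f i j != 0 -> M <= i%:R + t * j%:R) ->
  M <= qmval xi t f.
Proof.
move=> f0 fM; apply: lb_le_inf; last by move=> _ [i [j [cij ->]]]; exact: fM.
have [i [j [_ _ cij]]] := expansion_coef_top xi f0 (leqnSn (msize f)).
by exists (i%:R + t * j%:R); exists i, j.
Qed.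

Lemma qmval_le xi t f d : 0 <= t -> f != 0 -> (msize f <= d.+1)%N ->
  qmval xi t f <= d%:R + t * d%:R.
Proof.
move=> t0 f0 fd; have [i [j [id jd cij]]] := expansion_coef_top xi f0 fd.
apply: (@le_trans _ _ (i%:R + t * j%:R)); last first.
  by rewrite lerD ?ler_nat // ler_wpM2l ?ler_nat.
apply: ge_inf; last by exists i, j.
by exists 0 => _ [a [b [_ ->]]]; rewrite addr_ge0 ?mulr_ge0.
Qed.

Lemma mu_ge xi t f d : 0 <= t -> f != 0 -> (msize f <= d.+1)%N -> qmval xi t f <= mu d xi t.
Proof.
move=> t0 f0 fd; apply: ub_le_sup; last by exists f.
by exists (d%:R + t * d%:R) => _ [g [g0 gd] <-]; exact: qmval_le.
Qed.

Lemma msizeX_le d k f : f != 0 -> (msize f <= d.+1)%N -> (msize (f ^+ k) <= (k * d).+1)%N.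
Proof.
move=> f0 fd; elim: k => [|k IHk]; first by rewrite expr0 msize1.
rewrite exprS msizeM ?expf_neq0 // mulSn.
by move: (leq_add fd IHk); rewrite addSn addnS; move: (msize f + _)%N (d + _)%N => a b; lia.
Qed.

Lemma mu_weight_ge xi (r d M k : nat) f : f != 0 -> (msize f <= d.+1)%N ->
  weight_ge r M (bipoly K f \Po ('X + (truncation xi M)%:P)) ->
  (k * M)%:R <= mu (k * d) xi r%:R.
Proof.
move=> f0 fd fM; have fk0 : f ^+ k != 0 by rewrite expf_neq0.
apply: le_trans (mu_ge xi (ler0n _ _) fk0 (msizeX_le k f0 fd)).
apply: qmval_ge => // i j; rewrite -natrM -natrD ler_nat leqNgt.
apply: contraNN => ij; apply/eqP; pose n := maxn i M.
rewrite (expansion_coefE _ _ _ (leq_maxl i M)) (rmorphXn (bipoly K)) [_ \Po _]rmorphXn /=.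
apply: (weight_geX (M := M)) ij => a b ab.
have aM : (a <= M)%N by rewrite ltnW // (leq_ltn_trans (leq_addr _ _) ab).
apply: etrans (esym (expansion_coefE _ _ _ (leq_trans aM (leq_maxr i M)))) _.
by rewrite (expansion_coefE _ _ _ aM) fM.
Qed.

(** The powers f^k show that mu (k d) >= k M.  Positivity of [hat_mu] makes the
sequence convergent, as the limit of a divergent sequence is 0 by convention. *)
Lemma hat_mu_ge xi (r d M : nat) (f : {poly {poly K}}) : (0 < d)%N -> 0 < hat_mu xi r%:R ->
  tdeg_lt d.+1 f -> f != 0 -> weight_ge r M (f \Po ('X + (truncation xi M)%:P)) ->
  M%:R / d%:R <= hat_mu xi r%:R.
Proof.
move=> d0 pos /bipoly_surj[g <- gd]; rewrite bipoly_neq0 => g0 gM.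
rewrite leNgt; apply/negP => lt_mu.
have cv : cvgn (fun n => mu n xi r%:R / n%:R).
  apply: contrapT => ncv; move: pos; rewrite /hat_mu dvgP //.
  by rewrite ltxx.
have [N _ HN] := cvgr_lt _ cv _ lt_mu.
have : mu (N.+1 * d) xi r%:R / (N.+1 * d)%:R < M%:R / d%:R.
  by apply: HN; rewrite /= (leq_trans (leqnSn N)) // leq_pmulr.
rewrite ltNge => /negP; apply.
have -> : M%:R / d%:R = (N.+1 * M)%:R / (N.+1 * d)%:R :> R.
  by rewrite !natrM -mulf_div divff ?mul1r // pnatr_eq0.
rewrite ler_pM2r ?invr_gt0 ?ltr0n ?muln_gt0 ?d0 //.
exact: mu_weight_ge g0 gd gM.
Qed.
End Qmval.

(** * Very general series *)

Section Generic.
Open Scope classical_set_scope.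
Open Scope ring_scope.
Variable R : realType.
Notation K := (CC R).

(** Countably many polynomials have countably many roots, whereas the real
interval [0, 1] has positive Lebesgue measure. *)
Lemma exists_common_nonroot (Q : nat -> {poly K}) : (forall k, Q k != 0) ->
  exists c : K, forall k, (Q k).[c] != 0.
Proof.
move=> Q0; apply: contrapT => noc.
pose A := \bigcup_k [set x : R | root (Q k) (x%:C)%C].
have cA : countable A.
  apply: bigcup_countable => // k _.
  have [s sE] := closed_field_poly_normal (Q k).
  apply: (@sub_countable _ _ _ [set` map (@complex.Re R) s]).
    apply: subset_card_le => x /=; rewrite sE rootZ ?lead_coef_eq0 ?Q0 // root_prod_XsubC => xs.
    by apply/mapP; exists (x%:C)%C.
  exact/finite_set_countable/finite_seq.
have c01 : countable (`[0, 1]%classic : set R).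
  apply: sub_countable cA; apply: subset_card_le => x _.
  apply: contrapT => nA; apply: noc; exists (x%:C)%C => k.
  by apply/negP => rk; apply: nA; exists k.
have := countable_lebesgue_measure0 c01; rewrite lebesgue_measure_itv /= lte_fin ltr01.
by rewrite oppr0 adde0 => /eqP; rewrite eqe oner_eq0.
Qed.

Definition jet_value (N : nat) (F : {mpoly K[N]}) (xi : nat -> K) : K := meval (jet xi) F.

(** Nonvanishing of F at some completion of s, rather than at s itself, is what
can be preserved when the coefficients are chosen one by one. *)
Definition extendable (N : nat) (F : {mpoly K[N]}) (s : seq K) : Prop :=
  exists2 eta : nat -> K, (forall j, (j < size s)%N -> eta j = nth 0 s j) & jet_value F eta != 0.

(** Along a completion of s at which F is nonzero, F is a nonzero univariate
polynomial in the next coefficient. *)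
Lemma extendable_rcons (N : nat) (F : {mpoly K[N]}) (s : seq K) : extendable F s ->
  exists2 q : {poly K}, q != 0 & forall c, q.[c] != 0 -> extendable F (rcons s c).
Proof.
move=> [eta etas etaF]; pose n := size s.
pose eta' c j := if j == n then c else eta j.
pose q := mmap polyC (fun i : 'I_N => if i.+1 == n then 'X else (eta i.+1)%:P) F.
have qE c : q.[c] = jet_value F (eta' c).
  rewrite /q /mmap horner_sum /jet_value mevalE; apply: eq_bigr => m _.
  rewrite hornerM hornerC /mmap1 horner_prod; congr (_ * _); apply: eq_bigr => i _.
  by rewrite horner_exp /jet /eta'; case: (i.+1 == n); rewrite !hornerE.
exists q.
  apply: contraNneq etaF => q0; rewrite (_ : eta = eta' (eta n)); last first.
    by apply/funext => j; rewrite /eta'; case: eqP => // ->.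
  by rewrite -qE q0 horner0.
move=> c qc; exists (eta' c); last by rewrite -qE.
move=> j; rewrite size_rcons ltnS nth_rcons /eta' -/n leq_eqVlt.
by case: eqP => [->|_ /= jn]; rewrite ?ltnn ?eqxx // jn etas.
Qed.

Theorem very_general_series_exists (Q : (nat -> K) -> Prop) :
  for_very_general_series Q -> exists xi, Q xi.
Proof.
move=> [N [Z [Zproper ZQ]]].
have Fex (k : nat) : exists F : {mpoly K[N k]},
    (exists a, meval a F != 0) /\ forall a, Z k a -> meval a F = 0.
  have [[S ZE] ZT] := Zproper k.
  have [a nZa] : exists a, ~ Z k a.
    apply: contrapT => noa; move/eqP: ZT; apply; apply/seteqP; split => // a _.
    by apply: contrapT => na; apply: noa; exists a.
  have [F [SF Fa]] : exists F, S F /\ meval a F != 0.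
    apply: contrapT => noF; apply: nZa; rewrite ZE => F SF; apply/eqP.
    by apply: contrapT => /negP Fa; apply: noF; exists F.
  by exists F; split; [exists a|move=> b; rewrite ZE => /(_ F SF)].
pose F k := projT1 (cid (Fex k)).
have FP k : (exists a, meval a (F k) != 0) /\ forall a, Z k a -> meval a (F k) = 0.
  exact: projT2 (cid (Fex k)).
have /choice[g gP] (s : seq K) :
    exists c, forall k, extendable (F k) s -> extendable (F k) (rcons s c).
  have /choice[q qP] (k : nat) : exists q : {poly K}, q != 0 /\ forall c, q.[c] != 0 ->
       extendable (F k) s -> extendable (F k) (rcons s c).
    have [/extendable_rcons[q q0 qs]|next] := pselect (extendable (F k) s).
      by exists q; split => // c /qs.
    by exists 1; split; [exact: oner_neq0|].
  have [c cP] := exists_common_nonroot (fun k => (qP k).1).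
  by exists c => k; apply: (qP k).2.
pose st n := iter n (fun s => rcons s (g s)) [:: 0].
have size_st n : size (st n) = n.+1 by elim: n => //= n IH; rewrite size_rcons IH.
pose xi n := nth 0 (st n) n.
have st_xi n j : (j <= n)%N -> nth 0 (st n) j = xi j.
  elim: n => [|n IH]; first by rewrite leqn0 => /eqP ->.
  rewrite leq_eqVlt => /orP[/eqP -> //|jn]; rewrite /= nth_rcons size_st jn; exact: IH.
exists xi; apply: ZQ => // k Zk.
have ext n : extendable (F k) (st n).
  elim: n => [|n IH]; last exact: gP.
  have [[a Fa] _] := FP k.
  exists (fun j => if insub j.-1 is Some i then if j == 0%N then 0 else a i else 0).
    by case => //= _; case: insubP.
  rewrite /jet_value (_ : jet _ = a) //; apply/funext => i; rewrite /jet /=.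
  by rewrite insubT //= => ilt; congr a; apply: val_inj.
have [eta etas] := ext (N k); rewrite /jet_value (_ : jet eta = jet xi); last first.
  apply/funext => i; rewrite /jet etas ?size_st ?ltnS ?st_xi //.
by rewrite (FP k).2 ?eqxx.
Qed.
End Generic.

(** * From valuations to Nagata's inequality *)

(** When no common function exists, [generic_hat_mu] is the zero function by
convention. *)
Lemma generic_hat_mu_attained (R : realType) (t : R) : generic_hat_mu t != 0 ->
  for_very_general_series (fun xi => forall u : R, 1 <= u -> hat_mu xi u = generic_hat_mu u).
Proof.
move=> gt0.
have [ex|nex] := pselect (exists m : R -> R, for_very_general_series
    (fun xi => forall u, 1 <= u -> hat_mu xi u = m u)).
  exact: (xgetPex (fun=> 0) ex).
case/eqP: gt0; rewrite /generic_hat_mu xgetPN // => m mP.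
by apply: nex; exists m.
Qed.

Lemma sqr_ratio_is_square (M d r : nat) : (0 < d)%N -> (M ^ 2 = d ^ 2 * r)%N ->
  exists s, r = (s * s)%N /\ M = (s * d)%N.
Proof.
move=> d0 E; have /dvdnP[s sE] : (d %| M)%N by rewrite -(@dvdn_pexp2r _ _ 2) // E dvdn_mulr.
exists s; split => //; apply/eqP; rewrite -(@eqn_pmul2l (d ^ 2)) ?expn_gt0 ?d0 //.
by rewrite -E sE expnMn mulnC -mulnn.
Qed.

Theorem proposition4p4 (R : realType)
  (hmu : forall t : R, 9 <= t -> generic_hat_mu t = Num.sqrt t) :
  nagata_conjecture R.
Proof.
have /generic_hat_mu_attained/very_general_series_exists[xi xiP] : generic_hat_mu (9 : R) != 0.
  by rewrite hmu // sqrtr_eq0 -ltNge ltr0n.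
have {}xiP (r : nat) : (9 < r)%N -> hat_mu xi (r%:R : R) = Num.sqrt r%:R.
  by move=> r9; rewrite xiP ?hmu // ?ler_nat ?ler1n; lia.
move=> r r9; pose bad d (m : 'I_r -> nat) :=
  (0 < d)%N /\ d%:R * Num.sqrt (r%:R : R) <= (\sum_(i < r) m i)%:R.
have [|Z [Zproper ZP]] := @for_very_general_points_no_curve R r bad; last first.
  exists Z; split => // P confP nZ d F m d0 F0 homF Fm.
  by rewrite ltNge; apply/negP => dm; apply: (ZP P confP nZ d F m F0 homF Fm).
move=> d m [d0 dm]; apply: contrapT => nex.
have solv (x y : 'I_r -> CC R) : affine_solvable d m x y.
  by apply: contrapT => nsol; apply: nex; exists x, y.
have [f [Pf f0 fw]] := specialize_to_germ solv (truncation xi (\sum_i m i)).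
have r0 : 0 < Num.sqrt (r%:R : R) by rewrite sqrtr_gt0 ltr0n; lia.
have := @hat_mu_ge R xi r d (\sum_i m i) f d0; rewrite xiP // => /(_ r0 Pf f0 fw).
rewrite ler_pdivrMr ?ltr0n // mulrC => Md.
have E : (\sum_i m i)%:R = d%:R * Num.sqrt (r%:R : R) by apply/le_anti; rewrite Md dm.
have [|s [rE ME]] := @sqr_ratio_is_square (\sum_i m i) d r d0.
  apply/eqP; rewrite -(eqr_nat R) natrM !natrX E exprMn sqr_sqrtr //.
move: solv d0 ME; clear -r9 rE; subst r => solv d0 ME.
apply: (@square_not_all_solvable (CC R) s d m) => //; last by rewrite ME.
by move: r9; case: s {solv ME m} => [|[|[|[|]]]].
Qed.
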